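(* Let $\Psi$ be a Kempf-Ness function for $(\mathscr M,G,K)$. A point $x\in\mathscr M$ is $G$-stable if and only if it is $A$-stable for every abelian group $A=\exp(\mathfrak a)$, where $\mathfrak a$ is a subalgebra of $\mathfrak g$ contained in $\mathfrak p$.
   Context: $G$ is a non-compact real reductive Lie group: it has finitely many connected components, its Lie algebra is $\mathfrak g=[\mathfrak g,\mathfrak g]\oplus\mathfrak z(\mathfrak g)$ with $[\mathfrak g,\mathfrak g]$ semisimple, and it has a Cartan involution whose fixed point set $K$ is a maximal compact subgroup; $\mathfrak g=\mathfrak k\oplus\mathfrak p$ is the corresponding decomposition into $(+1)$- and $(-1)$-eigenspaces, and $K\times\mathfrak p\to G$, $(k,v)\mapsto k\exp(v)$, is a diffeomorphism. Since $[\mathfrak p,\mathfrak p]\subset\mathfrak k$, every subalgebra of $\mathfrak g$ contained in $\mathfrak p$ is abelian. $\mathscr M$ is a Hausdorff topological space with a continuous $G$-action; $G_x$ is the stabilizer of $x$ and $\mathfrak g_x$ its Lie algebra. A Kempf-Ness function for $(\mathscr M,G,K)$ is a function $\Psi:\mathscr M\times G\to\mathbb R$ such that: (P1) for every $x\in\mathscr M$, $\Psi(x,\cdot)$ is smooth on $G$; (P2) $\Psi(x,kg)=\Psi(x,g)$ for all $k\in K$, $g\in G$; (P3) for all $x\in\mathscr M$, $v\in\mathfrak p$, $t\in\mathbb R$: $\frac{d^2}{dt^2}\Psi(x,\exp(tv))\ge 0$, and $\frac{d^2}{dt^2}\big|_{t=0}\Psi(x,\exp(tv))=0$ if and only if $\exp(\mathbb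 R v)\subset G_x$; (P4) $\Psi(x,g)+\Psi(gx,h)=\Psi(x,hg)$ for all $x\in\mathscr M$, $g,h\in G$; (P5) the gradient map $\mathfrak F:\mathscr M\to\mathfrak p^*$, $\langle\mathfrak F(x),v\rangle=\frac{d}{dt}\big|_{t=0}\Psi(x,\exp(tv))$, is continuous. A point $x$ is $G$-stable if $Gx\cap\mathfrak F^{-1}(0)\neq\emptyset$ and $\mathfrak g_x$ is conjugate to a subalgebra of $\mathfrak k$. For $A=\exp(\mathfrak a)$ as in the claim (a compatible subgroup with trivial maximal compact subgroup), $\Psi|_{\mathscr M\times A}$ is a Kempf-Ness function for $(\mathscr M,A,\{e\})$ with gradient map $\mathfrak F^A(x)=\mathfrak F(x)|_{\mathfrak a}$; thus $x$ is $A$-stable if $Ax\cap(\mathfrak F^A)^{-1}(0)\ne\emptyset$ and $\mathfrak a_x=\{0\}$, where $\mathfrak a_x$ is the Lie algebra of the stabilizer of $x$ in $A$. *)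

(* Defs.v *)
From HB Require Import structures.
From mathcomp Require Import all_boot all_order all_algebra.
From mathcomp Require Import all_classical all_reals all_analysis.

Set Implicit Arguments.
Unset Strict Implicit.
Unset Printing Implicit Defensive.

Import Order.TTheory GRing.Theory Num.Theory.
Import numFieldNormedType.Exports.

Local Open Scope classical_set_scope.
Local Open Scope ring_scope.

Section SmoothMaps.
Context {R : realType}.

(* f is C^k on the open set U.  In finite dimension, differentiability at every
   point of U together with C^(k-1) directional derivatives is the usual C^k. *)
Fixpoint Ck (E F : normedModType R) (k : nat) (U : set E) (f : E -> F) : Prop :=
  match k with
  | 0%N => forall x, U x -> {for x, continuous f}
  | k'.+1 => (forall x, U x -> differentiable f x) /\
             (forall v, Ck k' U (fun x => 'D_v f x : F))
  end.

Definition Cinfty (E F : normedModType R) (U : set E) (f : E -> F) :=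
  forall k, Ck k U f.

(* A chart with values in E: [cfun] is only meaningful on [cdom], and [cinv]
   only on the image of [cdom] under [cfun]. *)
Record chart (T : topologicalType) (E : normedModType R) := Chart {
  cdom : set T;
  cfun : T -> E;
  cinv : E -> T
}.

Record is_chart (T : topologicalType) (E : normedModType R) (c : chart T E) :
    Prop := IsChart {
  chart_open_dom : open (cdom c);
  chart_open_img : open (cfun c @` cdom c);
  chart_cancel : forall x, cdom c x -> cinv c (cfun c x) = x;
  chart_continuous : forall x, cdom c x -> {for x, continuous (cfun c)};
  chart_inv_continuous :
    forall y, (cfun c @` cdom c) y -> {for y, continuous (cinv c)}
}.

Record is_atlas (T : topologicalType) (E : normedModType R)
    (A : set (chart T E)) : Prop := IsAtlas {
  atlas_chart : forall c, A c -> is_chart c;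
  atlas_cover : forall x, exists2 c, A c & cdom c x;
  atlas_compat : forall c d, A c -> A d ->
    Cinfty (cfun c @` (cdom c `&` cdom d)) (cfun d \o cinv c)
}.

Definition vec_atlas (E : normedModType R) : set (chart E E) :=
  [set Chart setT id id].

Definition prod_chart (T1 T2 : topologicalType) (E1 E2 : normedModType R)
    (c : chart T1 E1) (d : chart T2 E2) :
    chart (T1 * T2)%type (E1 * E2)%type :=
  Chart (cdom c `*` cdom d)
    (fun p => (cfun c p.1, cfun d p.2)) (fun q => (cinv c q.1, cinv d q.2)).

Definition prod_atlas (T1 T2 : topologicalType) (E1 E2 : normedModType R)
    (A : set (chart T1 E1)) (B : set (chart T2 E2)) :
    set (chart (T1 * T2)%type (E1 * E2)%type) :=
  [set e | exists c d, [/\ A c, B d & e = prod_chart c d]].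

Section Maps.
Variables (T1 T2 : topologicalType) (E1 E2 : normedModType R).
Variables (A : set (chart T1 E1)) (B : set (chart T2 E2)).

(* f is C^infty on some neighbourhood of x. *)
Definition smooth_at (f : T1 -> T2) (x : T1) :=
  {for x, continuous f} /\
  forall c d, A c -> B d -> cdom c x -> cdom d (f x) ->
    exists V : set E1,
      [/\ open V, V (cfun c x) & Cinfty V (cfun d \o f \o cinv c)].

Definition smooth (f : T1 -> T2) := forall x, smooth_at f x.

(* Smoothness on an arbitrary subset S, by local smooth extension.  When S is an
   embedded submanifold this is smoothness on S as a manifold. *)
Definition smooth_on (S : set T1) (f : T1 -> T2) :=
  forall x, S x -> exists F : T1 -> T2,
    smooth_at F x /\ \forall y \near x, S y -> F y = f y.

End Maps.

Definition diffeomorphism (T1 T2 : topologicalType) (E1 E2 : normedModType R)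
    (A : set (chart T1 E1)) (B : set (chart T2 E2))
    (S1 : set T1) (S2 : set T2) (f : T1 -> T2) :=
  smooth_on A B S1 f /\
  exists h : T2 -> T1, smooth_on B A S2 h /\
    [/\ forall x, S1 x -> S2 (f x), forall y, S2 y -> S1 (h y),
        forall x, S1 x -> h (f x) = x & forall y, S2 y -> f (h y) = y].

End SmoothMaps.

Arguments vec_atlas : clear implicits.

#[short(type="preTopologicalGroupType")]
HB.structure Definition PreTopologicalGroup := {G of Group G & Topological G}.

HB.mixin Record PreTopologicalGroup_isLieGroup (R : realType) (n : nat) G
    of PreTopologicalGroup G := {
  lie_atlas : set (chart G 'rV[R]_n);
  lie_atlasP : is_atlas lie_atlas;
  lie_hausdorff : hausdorff_space G;
  lie_second_countable : @second_countable G;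
  lie_mul_smooth : smooth (prod_atlas lie_atlas lie_atlas) lie_atlas
    (fun p : (G * G)%type => (p.1 * p.2)%g);
  lie_inv_smooth : smooth lie_atlas lie_atlas (fun g : G => g^-1%g)
}.

#[short(type="lieGroupType")]
HB.structure Definition LieGroup (R : realType) (n : nat) :=
  {G of PreTopologicalGroup G & PreTopologicalGroup_isLieGroup R n G}.

Section LieAlgebra.
Context {R : realType} {n : nat} (G : lieGroupType R n).

Notation atlasG := (@lie_atlas R n G).

Lemma chart1_exists : exists c, atlasG c /\ cdom c (1%g : G).
Proof. by have [c Ac c1] := atlas_cover (@lie_atlasP R n G) 1%g; exists c. Qed.

Definition chart1 : chart G 'rV[R]_n := sval (cid chart1_exists).

(* The Lie algebra of G is the tangent space at 1, identified with 'rV[R]_n by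
   the fixed chart [chart1] around 1. *)

(* Differential at 1 of a map f with f 1 = 1. *)
Definition tangent1 (f : G -> G) (X : 'rV[R]_n) : 'rV[R]_n :=
  'd (cfun chart1 \o f \o cinv chart1) (cfun chart1 (1%g : G)) X.

Definition Ad (g : G) : 'rV[R]_n -> 'rV[R]_n :=
  tangent1 (fun h => (g * h * g^-1)%g).

(* [X, Y] = ad X Y, where ad is the differential of Ad at 1. *)
Definition lie_bracket (X Y : 'rV[R]_n) : 'rV[R]_n :=
  'd (fun u : 'rV[R]_n => Ad (cinv chart1 u) Y) (cfun chart1 (1%g : G)) X.

Definition one_parameter (X : 'rV[R]_n) (gamma : R -> G) :=
  [/\ smooth (vec_atlas R R) atlasG gamma,
      forall s t, gamma (s + t) = (gamma s * gamma t)%g &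
      derive1 (cfun chart1 \o gamma) 0 = X].

(* The default value 1 is never used: every X generates exactly one one-parameter
   subgroup. *)
Definition expG (X : 'rV[R]_n) : G :=
  xget 1%g [set g | exists2 gamma, one_parameter X gamma & gamma 1 = g].

(* The Lie algebra of a closed subgroup H: the X with exp(tX) in H for all t. *)
Definition lie_alg (H : set G) : set 'rV[R]_n :=
  [set X | exists2 gamma, one_parameter X gamma & forall t, H (gamma t)].

Definition lie_derived (U : {vspace 'rV[R]_n}) : {vspace 'rV[R]_n} :=
  <<[seq lie_bracket u v | u <- vbasis U, v <- vbasis U]>>%VS.

Definition lie_solvable (U : {vspace 'rV[R]_n}) :=
  exists k, iter k lie_derived U = 0%VS.

Definition lie_subalgebra (U : {vspace 'rV[R]_n}) :=
  forall u v, u \in U -> v \in U -> lie_bracket u v \in U.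

Definition lie_ideal (I U : {vspace 'rV[R]_n}) :=
  (I <= U)%VS /\ forall u v, u \in U -> v \in I -> lie_bracket u v \in I.

(* Vanishing radical. *)
Definition lie_semisimple (U : {vspace 'rV[R]_n}) :=
  forall I, lie_ideal I U -> lie_solvable I -> I = 0%VS.

Definition lie_reductive :=
  let D := lie_derived fullv in
  exists Z : {vspace 'rV[R]_n},
    [/\ forall X, X \in Z <-> forall Y, lie_bracket X Y = 0,
        (D + Z)%VS = fullv, (D :&: Z)%VS = 0%VS & lie_semisimple D].

Definition killing (X Y : 'rV[R]_n) : R :=
  \tr (lin1_mx (lie_bracket X) *m lin1_mx (lie_bracket Y)).

Definition is_subgroup (H : set G) :=
  [/\ H 1%g, forall g h, H g -> H h -> H (g * h)%g &
      forall g, H g -> H g^-1%g].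

Definition maximal_compact (K : set G) :=
  [/\ is_subgroup K, compact K &
      forall H, is_subgroup H -> compact H -> K `<=` H -> H = K].

Definition kpart (Theta : G -> G) : set 'rV[R]_n :=
  [set X | tangent1 Theta X = X].

Definition ppart (Theta : G -> G) : set 'rV[R]_n :=
  [set X | tangent1 Theta X = - X].

(* Theta is a Cartan involution of G: a smooth involutive automorphism whose
   differential is a Cartan involution of the semisimple part of the Lie
   algebra. *)
Definition cartan_involution (Theta : G -> G) :=
  [/\ smooth atlasG atlasG Theta,
      forall g h, Theta (g * h)%g = (Theta g * Theta h)%g,
      involutive Theta &
      forall X, X \in lie_derived fullv -> X != 0 ->
        0 < - killing X (tangent1 Theta X)].

Record real_reductive (Theta : G -> G) (K : set G) : Prop := RealReductive {
  red_components :
    finite_set (range (fun g : G => connected_component [set: G] g));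
  red_algebra : lie_reductive;
  red_cartan : cartan_involution Theta;
  red_fixed : K = [set g | Theta g = g];
  red_maximal_compact : maximal_compact K;
  red_polar :
    diffeomorphism (prod_atlas atlasG (vec_atlas R 'rV[R]_n)) atlasG
      (K `*` ppart Theta) [set: G] (fun q => (q.1 * expG q.2)%g)
}.

Section KempfNess.
Variables (Theta : G -> G) (K : set G).
Variables (M : topologicalType) (act : G -> M -> M) (Psi : M -> G -> R).

Definition continuous_action :=
  [/\ forall x, act 1%g x = x,
      forall g h x, act (g * h)%g x = act g (act h x) &
      continuous (fun q : (G * M)%type => act q.1 q.2)].

Definition stabilizer (x : M) : set G := [set g | act g x = x].

Definition gradient_map (x : M) (v : 'rV[R]_n) : R :=
  derive1 (fun t : R => Psi x (expG (t *: v))) 0.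

(* In [kn_continuous], the topology of the finite-dimensional dual of
   [ppart Theta] is that of pointwise convergence. *)
Record kempf_ness : Prop := KempfNess {
  kn_smooth : forall x, smooth atlasG (vec_atlas R R) (Psi x);
  kn_invariant : forall x k g, K k -> Psi x (k * g)%g = Psi x g;
  kn_convex : forall x v t, ppart Theta v ->
    0 <= derive1n 2 (fun s : R => Psi x (expG (s *: v))) t;
  kn_flat : forall x v, ppart Theta v ->
    (derive1n 2 (fun s : R => Psi x (expG (s *: v))) 0 = 0 <->
     forall t : R, stabilizer x (expG (t *: v)));
  kn_cocycle : forall x g h,
    Psi x g + Psi (act g x) h = Psi x (h * g)%g;
  kn_continuous : forall v, ppart Theta v ->
    continuous (fun x => gradient_map x v)
}.

(* Ad g carries subalgebras to subalgebras, so "conjugate to a subalgebra of k"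
   is an inclusion in k of an Ad-translate. *)
Definition G_stable (x : M) :=
  (exists g, forall v, ppart Theta v -> gradient_map (act g x) v = 0) /\
  (exists g, Ad g @` lie_alg (stabilizer x) `<=` kpart Theta).

Definition exp_group (a : {vspace 'rV[R]_n}) : set G :=
  [set expG v | v in [set` a]].

(* Here A = exp a has trivial maximal compact subgroup. *)
Definition A_stable (a : {vspace 'rV[R]_n}) (x : M) :=
  (exists2 g, exp_group a g &
     forall v, v \in a -> gradient_map (act g x) v = 0) /\
  lie_alg (stabilizer x `&` exp_group a) = [set 0].

End KempfNess.
End LieAlgebra.

(* Main.v *)
(* Write [f_v t = Psi x (exp (t v))] for v in p; it is convex with [f_v 0 = 0],
   and by the cocycle identity its slope and its second derivative at t are those
   at 0 of the same function based at [exp (t v) x].  Hence (P3) says that f_v is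
   strictly convex at each critical point unless exp(Rv) fixes x.
   If x is A-stable for every line A = exp(Rv), then every f_v, v != 0, becomes
   positive, and convexity with compactness of the unit sphere of p makes
   [Psi x] proper modulo K.  So it attains its minimum at some g; the gradient
   vanishes at gx, and properness forces the stabilizer of gx into K.
   Conversely, if the gradient vanishes at y = gx and the stabilizer algebra is
   conjugate into k, then exp(Rv) in G_y is relatively compact, so v = 0; thus
   [Psi y], and then [Psi x], is proper modulo K and attains a minimum on exp(a).
   No existence theorem for one-parameter subgroups is needed: the exponential is
   only used on p, where the polar decomposition forces them to exist. *)
Require Import Defs.
From HB Require Import structures.
From mathcomp Require Import all_boot all_order all_algebra.
From mathcomp Require Import ring lra.
From mathcomp Require Import all_classical all_reals all_analysis.
Set Implicit Arguments.
Unset Strict Implicit.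
Unset Printing Implicit Defensive.

Import Order.TTheory GRing.Theory Num.Theory.
Import numFieldNormedType.Exports.
Local Open Scope classical_set_scope.
Local Open Scope ring_scope.

(** * Calculus of C^k maps *)

Section CkCalculus.
Context {R : realType}.
Implicit Types E F H : normedModType R.

(** Only the germ matters: the first-order expansion of [f] at [x] carries over to [g], and
    uniqueness of the differential identifies the linear part. *)
Lemma near_differentiable E F (f g : E -> F) (x : E) :
  (\forall y \near x, f y = g y) -> differentiable f x -> differentiable g x.
Proof.
move=> fg df; have fgx : f x = g x := nbhs_singleton fg.
have [dc dE] := (iffLR (diff_locallyP _ _)) df.
have gE : g \o shift x = cst (g x) + 'd f x +o_ 0 id.
  apply/eqaddoP => e e0; have := dE => /eqaddoP /(_ e e0).
  apply: filter_app; move: fg; rewrite (near_shift 0 x) /= subr0.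
  by apply: filterS => y /= /[!fctE] /= ->; rewrite -fgx.
by apply/diff_locallyP; rewrite (diff_unique dc gE); split.
Qed.

(** With scaling registered as a bilinear map, the product rule [is_diff_scale] is the differential
    of a bilinear map composed with a pair. *)
Lemma scale_is_bilinear E :
  bilinear_for
    (GRing.Scale.Law.clone _ _ *:%R _) (GRing.Scale.Law.clone _ _ *:%R _)
    (@GRing.scale R E).
Proof.
split=> [u'|u] a x y /=.
- by rewrite scalerDl scalerA.
- by rewrite scalerDr !scalerA mulrC.
Qed.

HB.instance Definition _ E := bilinear_isBilinear.Build R R^o E E _ _
  (@GRing.scale R E) (scale_is_bilinear E).

Lemma is_diff_scale E F (a da : E -> R) (f df : E -> F) x :
  is_diff x a da -> is_diff x f df ->
  is_diff x (fun y => a y *: f y) (fun v => a x *: df v + da v *: f x).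
Proof.
move=> dax dfx.
pose s : {bilinear R^o -> F -> F} := @GRing.scale R F.
have sc : continuous (fun p : R^o * F => s p.1 p.2) by exact: scale_continuous.
have ds p : is_diff p (fun q : R^o * F => s q.1 q.2)
    (fun q => s p.1 q.2 + s q.1 p.2).
  by apply: DiffDef; [exact: differentiable_bilin | exact: diff_bilin].
have := @is_diff_comp _ _ _ _ (fun y => (a y : R^o, f y)) _ _ _ x
  (is_diff_pair dax dfx) (ds _).
by [].
Qed.

Lemma near_continuous (T U : topologicalType) (f g : T -> U) (x : T) :
  (\forall y \near x, f y = g y) -> {for x, continuous f} ->
  {for x, continuous g}.
Proof.
move=> fg; rewrite /prop_for /continuous_at -(nbhs_singleton fg).
by apply: cvg_trans; apply: near_eq_cvg; apply: filterS fg => y /= ->.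
Qed.

Lemma open_near (T : topologicalType) (U : set T) (P : T -> Prop) x :
  open U -> U x -> (forall y, U y -> P y) -> \forall y \near x, P y.
Proof. by move=> oU Ux UP; apply: filterS UP _; exact: open_nbhs_nbhs. Qed.

(** Directional derivatives see a whole neighbourhood, so equality on [U] passes to them because [U]
    is open. *)
Lemma Ck_ext E F k (U : set E) (f g : E -> F) :
  open U -> (forall x, U x -> f x = g x) -> Ck k U f -> Ck k U g.
Proof.
move=> oU; elim: k f g => [|k IH] f g fg /=.
  by move=> cf x Ux; apply: near_continuous (cf x Ux); exact: open_near fg.
move=> [df Df]; split=> [x Ux|v].
  by apply: near_differentiable (df x Ux); exact: open_near fg.
apply: IH (Df v) => x Ux.
by apply: near_eq_derive; exact: open_near fg.
Qed.

Lemma Ck_sub E F k (U V : set E) (f : E -> F) :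
  U `<=` V -> Ck k V f -> Ck k U f.
Proof.
move=> UV; elim: k f => [|k IH] f /=; first by move=> cf x /UV; exact: cf.
by move=> [df Df]; split=> [x /UV /df //|v]; exact: IH.
Qed.

Lemma CkS E F k (U : set E) (f : E -> F) : Ck k.+1 U f -> Ck k U f.
Proof.
elim: k f => [|k IH] f [df Df].
  by move=> x Ux; apply: differentiable_continuous; exact: df.
by split=> // v; exact: IH.
Qed.

Lemma Ck_cst E F k (U : set E) (a : F) : Ck k U (cst a).
Proof.
elim: k a => [|k IH] a /=; first by move=> x _; exact: cst_continuous.
split=> [x _|v]; first exact: differentiable_cst.
rewrite (_ : (fun x => _) = cst 0); first exact: IH.
by apply/funext => x; rewrite derive_cst.
Qed.

Lemma Ck_add E F k (U : set E) (f g : E -> F) : open U ->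
  Ck k U f -> Ck k U g -> Ck k U (fun x => f x + g x).
Proof.
move=> oU; elim: k f g => [|k IH] f g /=.
  by move=> cf cg x Ux; apply: continuousD; [exact: cf|exact: cg].
move=> [df Df] [dg Dg]; split=> [x Ux|v].
  exact: differentiableD (df x Ux) (dg x Ux).
apply: Ck_ext (IH _ _ (Df v) (Dg v)) => // x Ux.
by rewrite -[RHS]/('D_v (f + g) x) deriveD//; apply: diff_derivable; auto.
Qed.

Lemma Ck_sum E F k m (U : set E) (f : 'I_m -> E -> F) : open U ->
  (forall i, Ck k U (f i)) -> Ck k U (fun x => \sum_(i < m) f i x).
Proof.
move=> oU; elim: m f => [|m IH] f Cf.
  by apply: Ck_ext (Ck_cst k U 0) => // x _; rewrite big_ord0.
have := Ck_add oU (IH (fun i => f (widen_ord (leqnSn m) i)) (fun i => Cf _))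
  (Cf ord_max).
by apply: Ck_ext => // x _; rewrite big_ord_recr.
Qed.

Lemma Ck_scale E F k (U : set E) (a : E -> R) (f : E -> F) : open U ->
  Ck k U a -> Ck k U f -> Ck k U (fun x => a x *: f x).
Proof.
move=> oU; elim: k a f => [|k IH] a f Ca Cf.
  by move=> x Ux; apply: continuousZ; [exact: Ca|exact: Cf].
have [da Da] := Ca; have [df Df] := Cf.
have dS x : U x -> is_diff x (fun y => a y *: f y)
    (fun v => a x *: 'd f x v + 'd a x v *: f x).
  move=> Ux.
  by apply: is_diff_scale; apply: differentiableP; [exact: da|exact: df].
split=> [x Ux|v]; first by have [] := dS x Ux.
apply: Ck_ext (Ck_add oU (IH _ _ (CkS Ca) (Df v)) (IH _ _ (Da v) (CkS Cf))).
  by [].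
move=> x Ux; have [d1 d2] := dS x Ux.
by rewrite [RHS]deriveE// d2 !deriveE//; [exact: da|exact: df].
Qed.

Lemma Ck_linear E F H k (U : set E) (l : {linear F -> H}) (f : E -> F) :
  open U -> continuous l -> Ck k U f -> Ck k U (l \o f).
Proof.
move=> oU cl; elim: k f => [|k IH] f Cf.
  by move=> x Ux; apply: continuous_comp (cl _); exact: Cf.
have [df Df] := Cf.
split=> [x Ux|v].
  by apply: differentiable_comp (df x Ux) _; exact: linear_differentiable.
apply: Ck_ext (IH _ (Df v)) => // x Ux.
have dl := linear_differentiable (f x) cl.
rewrite deriveE; last exact: differentiable_comp (df x Ux) dl.
by rewrite diff_comp ?diff_lin//= ?deriveE//; exact: df.
Qed.

(* Continuous coordinates: in finite dimension they let the chain rule be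
   written with directional derivatives along a fixed basis, which is what the
   recursive definition of [Ck] sees. *)
Definition has_coordinates E := exists m (e : 'I_m -> E)
    (phi : 'I_m -> {linear E -> R}),
  (forall i, continuous (phi i)) /\
  forall x, x = \sum_(i < m) phi i x *: e i.

(** By the chain rule, the derivative of the composite along [v] is the sum over [i] of the [i]-th
    coordinate of ['D_v c] times ['D_(e i) f] composed with [c]. The last factor is again a
    composite, so induction on [k] applies. *)
Lemma Ck_comp E F H k (U : set E) (V : set F) (c : E -> F) (f : F -> H) :
  has_coordinates F -> open U -> (forall x, U x -> V (c x)) ->
  Ck k U c -> Ck k V f -> Ck k U (f \o c).
Proof.
move=> [m [e [phi [cphi phiE]]]] oU UV; elim: k f => [|k IH] f Cc Cf.
  by move=> x Ux; apply: continuous_comp; [exact: Cc|apply: Cf; exact: UV].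
have [dc Dc] := Cc; have [df Df] := Cf.
have dfc x : U x -> differentiable (f \o c) x.
  by move=> Ux; apply: differentiable_comp; [exact: dc|apply: df; exact: UV].
split=> [x /dfc //|v].
have C0 : Ck k U (fun x =>
    \sum_(i < m) (phi i \o (fun x => 'D_v c x)) x *:
                 ((fun y => 'D_(e i) f y) \o c) x).
  apply: Ck_sum => // i; apply: Ck_scale => //.
    by apply: (Ck_linear oU (cphi i) (Dc v)).
  exact: IH (CkS Cc) (Df (e i)).
apply: Ck_ext C0 => // x Ux /=; rewrite [RHS]deriveE; last exact: dfc.
rewrite (diff_comp (dc _ Ux) (df _ (UV _ Ux))).
have /= -> : 'd c x v = 'D_v c x by rewrite deriveE//; exact: dc.
rewrite [in RHS](phiE ('D_v c x)) linear_sum; apply: eq_bigr => i _.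
by rewrite linearZ; congr (_ *: _); rewrite deriveE//; apply: df; exact: UV.
Qed.

Lemma Ck_pair E F H k (U : set E) (f : E -> F) (g : E -> H) : open U ->
  Ck k U f -> Ck k U g -> Ck k U (fun x => (f x, g x)).
Proof.
move=> oU; elim: k f g => [|k IH] f g Cf Cg.
  by move=> x Ux; apply: cvg_pair; [exact: Cf|exact: Cg].
have [df Df] := Cf; have [dg Dg] := Cg.
have dp x : U x -> is_diff x (fun y => (f y, g y))
    (fun v => ('d f x v, 'd g x v)).
  by move=> Ux; apply: is_diff_pair; apply: differentiableP;
    [exact: df|exact: dg].
split=> [x Ux|v]; first by have [] := dp x Ux.
apply: Ck_ext (IH _ _ (Df v) (Dg v)) => // x Ux.
have [d1 d2] := dp x Ux.
by rewrite [RHS]deriveE// d2 !deriveE//; [exact: dg|exact: df].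
Qed.

Lemma has_coordinates_rV n : has_coordinates 'rV[R]_n.
Proof.
pose phi (i : 'I_n) (v : 'rV[R]_n) : R := v 0 i.
have lphi i : linear (phi i) by move=> a u v; rewrite /phi !mxE.
pose phiM i := GRing.isLinear.Build _ _ _ _ _ (lphi i).
pose phiL i : {linear 'rV[R]_n -> R} := HB.pack (phi i) (phiM i).
exists n, (fun i => delta_mx 0 i), phiL; split=> [i|x].
  exact: coord_continuous.
exact: row_sum_delta.
Qed.

(** Needed to compose with the group law, whose source has charts in a product space. *)
Lemma has_coordinates_prod E F :
  has_coordinates E -> has_coordinates F -> has_coordinates (E * F)%type.
Proof.
move=> [m [e [phi [cphi phiE]]]] [p [f [psi [cpsi psiE]]]].
pose th (i : 'I_(m + p)) (z : E * F) : R :=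
  match fintype.split i with inl j => phi j z.1 | inr j => psi j z.2 end.
have lth i : linear (th i).
  by move=> a u v; rewrite /th; case: (fintype.split i) => j /=; rewrite linearP.
pose thM i := GRing.isLinear.Build _ _ _ _ _ (lth i).
pose thL i : {linear (E * F)%type -> R} := HB.pack (th i) (thM i).
exists (m + p)%N, (fun i => match fintype.split i with
  inl j => (e j, 0) | inr j => (0, f j) end), thL; split=> [i z|[x y]].
  rewrite /continuous_at /= /th; case: (fintype.split i) => j.
    by apply: (@continuous_comp _ _ _ fst (phi j)); [exact: cvg_fst|exact: cphi].
  by apply: (@continuous_comp _ _ _ snd (psi j)); [exact: cvg_snd|exact: cpsi].
rewrite big_split_ord /= /th.
under eq_bigr => i _ do rewrite (unsplitK (inl i)).
under [X in _ = _ + X]eq_bigr => i _ do rewrite (unsplitK (inr i)).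
have -> : \sum_(i < m) phi i x *: ((e i, 0) : E * F) = (x, 0).
  rewrite [in RHS](phiE x); elim/big_rec2: _ => // i u v _ ->.
  by congr (_, _); rewrite /= scaler0 add0r.
have -> : \sum_(i < p) psi i y *: ((0, f i) : E * F) = (0, y).
  rewrite [in RHS](psiE y); elim/big_rec2: _ => // i u v _ ->.
  by congr (_, _); rewrite /= scaler0 add0r.
by congr (_, _); rewrite /= ?addr0 ?add0r.
Qed.

(* The default value of ['d] is 0, so brackets along a line vanish whether or
   not the differentiability of [u |-> Ad (cinv chart1 u) v] is known. *)
Lemma diff_nondifferentiable (E F : normedModType R) (f : E -> F) z :
  ~ differentiable f z -> 'd f z = 0 :> (E -> F).
Proof.
move=> nf; rewrite /diff; set P := (X in get X).
have [exP|noP] := pselect (exists df, P df).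
  by case: nf; apply/diffP; exact: (getPex exP).
by rewrite getPN// => df Pdf; apply: noP; exists df.
Qed.

End CkCalculus.

(** * Smooth maps in charts *)

Section SmoothMaps.
Context {R : realType}.

(** Composition of smooth maps asks this much of an atlas, and it passes easily to products.
    Compatibility of charts enters in [smooth_at_id]. *)
Definition covering_charts (T : topologicalType) (E : normedModType R)
    (A : set (chart T E)) :=
  (forall c, A c -> is_chart c) /\ forall x, exists2 c, A c & cdom c x.

Lemma atlas_covering (T : topologicalType) (E : normedModType R)
  (A : set (chart T E)) : is_atlas A -> covering_charts A.
Proof. by move=> hA; split; [exact: atlas_chart | exact: atlas_cover]. Qed.

Lemma vec_atlas_covering (E : normedModType R) : covering_charts (vec_atlas R E).
Proof.
split=> [_ ->|x]; last by exists (Chart setT id id).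
split=> //=; first exact: openT.
- by rewrite image_id; exact: openT.
- by move=> x _; exact: cvg_id.
- by move=> x _; exact: cvg_id.
Qed.

Lemma near_cinv (T : topologicalType) (E : normedModType R) (c : chart T E)
    (W : set T) x : is_chart c -> cdom c x -> nbhs x W ->
  \forall u \near cfun c x, W (cinv c u).
Proof.
move=> hc cx Wx.
have := @chart_inv_continuous _ _ _ _ hc (cfun c x) (imageP _ cx).
by rewrite /prop_for /continuous_at (chart_cancel hc cx) => /(_ _ Wx).
Qed.

Lemma near_chart_dom (T : topologicalType) (E : normedModType R)
    (c : chart T E) x : is_chart c -> cdom c x -> \forall y \near x, cdom c y.
Proof. by move=> hc cx; apply: open_nbhs_nbhs; split=> //; exact: chart_open_dom. Qed.

Lemma cinvK (T : topologicalType) (E : normedModType R) (c : chart T E) u :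
  is_chart c -> (cfun c @` cdom c) u -> cfun c (cinv c u) = u.
Proof. by move=> hc [x cx <-]; rewrite (chart_cancel hc). Qed.

Lemma near_cinvK (T : topologicalType) (E : normedModType R) (c : chart T E) x :
  is_chart c -> cdom c x -> \forall u \near cfun c x, cfun c (cinv c u) = u.
Proof.
move=> hc cx; apply: (@open_near _ (cfun c @` cdom c)).
- exact: chart_open_img.
- exact: imageP.
- by move=> u; exact: cinvK.
Qed.

Section Composition.
Variables (T1 T2 T3 : topologicalType) (E1 E2 E3 : normedModType R).
Variables (A : set (chart T1 E1)) (B : set (chart T2 E2)).
Variable (C : set (chart T3 E3)).

Lemma smooth_at_comp (f : T1 -> T2) (g : T2 -> T3) (x : T1) :
  has_coordinates E2 -> covering_charts A -> covering_charts B ->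
  smooth_at A B f x -> smooth_at B C g (f x) -> smooth_at A C (g \o f) x.
Proof.
move=> hE [hA _] [hB covB] [cf Sf] [cg Sg].
split=> [|c e Ac Ce cx ex]; first exact: continuous_comp cf cg.
have [d Bd dfx] := covB (f x).
have [V1 [oV1 V1x CV1]] := Sf c d Ac Bd cx dfx.
have [V2 [oV2 V2x CV2]] := Sg d e Bd Ce dfx ex.
have hc := hA c Ac; have hd := hB d Bd.
pose u := cfun c x.
have Nd : \forall w \near u, cdom d (f (cinv c w)).
  by apply: (near_cinv hc cx (W := [set y | cdom d (f y)])); apply: cf;
    exact: near_chart_dom.
have N2 : \forall w \near u, V2 (cfun d (f (cinv c w))).
  apply: (near_cinv hc cx (W := [set y | V2 (cfun d (f y))])).
  apply: (continuous_comp cf (chart_continuous hd dfx)).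
  by apply: open_nbhs_nbhs.
(* Shrink [V1] to points that [f] sends into the domain of the middle chart [d], with coordinates in
   [V2]; there the [d]-coordinates cancel. *)
pose V := V1 `&` interior [set w | cdom d (f (cinv c w)) /\
                                   V2 (cfun d (f (cinv c w)))].
have oV : open V by apply: openI => //; exact: open_interior.
exists V; split=> //; first by split=> //; exact: filterI.
move=> k.
have := Ck_comp hE oV (V := V2) (f := cfun e \o g \o cinv d)
  (c := cfun d \o f \o cinv c) _ (Ck_sub (@subIsetl _ _ _) (CV1 k)) (CV2 k).
move=> H; apply: Ck_ext (H _) => //.
- by move=> w [_ /interior_subset[dw _]] /=; rewrite (chart_cancel hd).
- by move=> w [_ /interior_subset[_ ?]].
Qed.

Lemma smooth_at_pair (f : T1 -> T2) (g : T1 -> T3) (x : T1) :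
  smooth_at A B f x -> smooth_at A C g x ->
  smooth_at A (prod_atlas B C) (fun y => (f y, g y)) x.
Proof.
move=> [cf Sf] [cg Sg]; split=> [|c e Ac [d1 [d2 [Bd1 Cd2 ->]]] cx [/= d1x d2x]].
  exact: cvg_pair.
have [V1 [oV1 V1x CV1]] := Sf c d1 Ac Bd1 cx d1x.
have [V2 [oV2 V2x CV2]] := Sg c d2 Ac Cd2 cx d2x.
have oV := openI oV1 oV2; exists (V1 `&` V2); split=> // k.
by have := Ck_pair oV (Ck_sub (@subIsetl _ _ _) (CV1 k))
  (Ck_sub (@subIsetr _ _ _) (CV2 k)).
Qed.

Lemma smooth_at_cst (y : T2) (x : T1) : smooth_at A B (cst y) x.
Proof.
split=> [|c d Ac Bd cx dy]; first exact: cst_continuous.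
by exists setT; split=> //; [exact: openT | move=> k; exact: (Ck_cst k setT (cfun d y))].
Qed.

End Composition.

Lemma prod_atlas_covering (T1 T2 : topologicalType) (E1 E2 : normedModType R)
    (A : set (chart T1 E1)) (B : set (chart T2 E2)) :
  covering_charts A -> covering_charts B -> covering_charts (prod_atlas A B).
Proof.
move=> [hA covA] [hB covB].
have openX (S1 S2 : topologicalType) (U : set S1) (V : set S2) :
    open U -> open V -> open (U `*` V).
  rewrite !openE => oU oV [x y] [/= Ux Vy].
  by exists (U, V) => //=; split; [exact: oU|exact: oV].
split=> [_ [c [d [/hA hc /hB hd ->]]]|[x y]]; last first.
  have [c Ac cx] := covA x; have [d Bd dy] := covB y.
  by exists (prod_chart c d) => //; exists c, d.
have imgE : cfun (prod_chart c d) @` cdom (prod_chart c d) =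
    (cfun c @` cdom c) `*` (cfun d @` cdom d).
  apply/seteqP; split=> [_ [[x y] [/= cx dy] <-]|[_ _] [/= [x cx <-] [y dy <-]]].
    by split; exact: imageP.
  by exists (x, y).
split.
- by apply: openX; exact: chart_open_dom.
- by rewrite imgE; apply: openX; exact: chart_open_img.
- by move=> [x y] [/= cx dy]; rewrite (chart_cancel hc cx) (chart_cancel hd dy).
- move=> [x y] [/= cx dy]; apply: cvg_pair.
    apply: (@continuous_comp _ _ _ fst (cfun c)); first exact: cvg_fst.
    exact: chart_continuous.
  apply: (@continuous_comp _ _ _ snd (cfun d)); first exact: cvg_snd.
  exact: chart_continuous.
- move=> [u v]; rewrite imgE => -[/= cu dv]; apply: cvg_pair.
    apply: (@continuous_comp _ _ _ fst (cinv c)); first exact: cvg_fst.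
    exact: chart_inv_continuous.
  apply: (@continuous_comp _ _ _ snd (cinv d)); first exact: cvg_snd.
  exact: chart_inv_continuous.
Qed.

(** Read in two charts, the identity is a transition map, smooth by compatibility. What remains is
    that the image of the overlap is open. *)
Lemma smooth_at_id (T : topologicalType) (E : normedModType R)
  (A : set (chart T E)) (x : T) : is_atlas A -> smooth_at A A id x.
Proof.
move=> hA; split=> [|c d Ac Ad cx dx]; first exact: cvg_id.
have hc := atlas_chart hA Ac; have hd := atlas_chart hA Ad.
exists (cfun c @` (cdom c `&` cdom d)); split=> //.
- rewrite openE => _ [y [cy dy] <-]; rewrite /interior.
  have N1 := near_cinv hc cy (near_chart_dom hd dy).
  have N2 := near_cinv hc cy (near_chart_dom hc cy).
  have N3 := near_cinvK hc cy.
  by near=> u; exists (cinv c u); [split; near: u | near: u].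
- exact: imageP.
- exact: (atlas_compat hA).
Unshelve. all: by end_near. Qed.

Lemma smooth_at_vec (E F : normedModType R) (f : E -> F) (x : E) :
  smooth_at (vec_atlas R E) (vec_atlas R F) f x ->
  exists V : set E, [/\ open V, V x & Cinfty V f].
Proof. by case=> _ /(_ _ _ erefl erefl I I). Qed.

Lemma smooth_derivable (F : normedModType R) (f : R -> F) :
  smooth (vec_atlas R R) (vec_atlas R F) f -> forall t, derivable f t 1.
Proof.
move=> sf t; have [V [oV Vt Cf]] := smooth_at_vec (sf t).
by apply: diff_derivable; exact: (Cf 1%N).1.
Qed.

Lemma smooth_derivable2 (F : normedModType R) (f : R -> F) :
  smooth (vec_atlas R R) (vec_atlas R F) f -> forall t, derivable (derive1 f) t 1.
Proof.
move=> sf t; have [V [oV Vt Cf]] := smooth_at_vec (sf t).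
have [_ /(_ 1) [D1 _]] := Cf 2%N.
rewrite (_ : derive1 f = fun x => 'D_1 f x); last first.
  by apply/funext => x; rewrite derive1E.
exact: diff_derivable (D1 t Vt).
Qed.

Lemma is_derive_diff_comp (E F : normedModType R) (c : R -> E) (f : E -> F) (t : R) X :
  is_derive t (1 : R) c X -> differentiable f (c t) ->
  is_derive t (1 : R) (f \o c) ('d f (c t) X).
Proof.
move=> [dc cX] df; have /derivable1_diffP dc' := dc.
have dfc := differentiable_comp dc' df.
split; first exact: diff_derivable.
by rewrite deriveE// diff_comp//= -cX deriveE.
Qed.

End SmoothMaps.

(** * One-parameter subgroups *)

Section LieGroups.
Context {R : realType} {n : nat} {G : lieGroupType R n}.
Implicit Types (g h : G) (X Y : 'rV[R]_n) (alpha beta gamma : R -> G).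

Notation atlasG := (@lie_atlas R n G).
Notation chartG := (cfun (chart1 G)).
Notation chartV := (cinv (chart1 G)).
Notation unitG := (chartG 1%g).

Let rV_coord : has_coordinates 'rV[R]_n := has_coordinates_rV n.
Let atlas_cov : covering_charts atlasG := atlas_covering (@lie_atlasP R n G).

Lemma chart1_atlas : atlasG (chart1 G).
Proof. by rewrite /chart1; case: (cid _) => c []. Qed.

Lemma chart1_dom : cdom (chart1 G) (1%g : G).
Proof. by rewrite /chart1; case: (cid _) => c []. Qed.

Lemma chart1_is_chart : is_chart (chart1 G).
Proof. exact: atlas_chart (@lie_atlasP R n G) _ chart1_atlas. Qed.

Lemma is_derive_unique (c : R -> 'rV[R]_n) (t : R) X Y :
  is_derive t (1 : R) c X -> is_derive t (1 : R) c Y -> X = Y.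
Proof. by move=> [_ <-] [_ <-]. Qed.

Lemma smooth_at_mul (T : topologicalType) (E : normedModType R)
    (A : set (chart T E)) (f f' : T -> G) x : covering_charts A ->
  smooth_at A atlasG f x -> smooth_at A atlasG f' x ->
  smooth_at A atlasG (fun y => (f y * f' y)%g) x.
Proof.
move=> hA sf sf'.
apply: (smooth_at_comp (B := prod_atlas atlasG atlasG)
  (f := fun y => (f y, f' y)) (g := fun p => (p.1 * p.2)%g)).
- exact: has_coordinates_prod.
- exact: hA.
- exact: prod_atlas_covering.
- exact: smooth_at_pair.
- exact: lie_mul_smooth.
Qed.

Lemma smooth_translate g h : smooth atlasG atlasG (fun z => (g * z * h)%g).
Proof.
move=> x; apply: smooth_at_mul => //; last exact: smooth_at_cst.
apply: smooth_at_mul => //; first exact: smooth_at_cst.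
exact: smooth_at_id lie_atlasP.
Qed.

Lemma smooth_curve_translate g h gamma :
  smooth (vec_atlas R R) atlasG gamma ->
  smooth (vec_atlas R R) atlasG (fun t => (g * gamma t * h)%g).
Proof.
move=> sg t; have := smooth_at_comp (B := atlasG) rV_coord
  (vec_atlas_covering R) atlas_cov (sg t) (smooth_translate g h (gamma t)).
by [].
Qed.

Lemma smooth_comp_curve (E : normedModType R) (f : G -> E) gamma :
  smooth atlasG (vec_atlas R E) f -> smooth (vec_atlas R R) atlasG gamma ->
  smooth (vec_atlas R R) (vec_atlas R E) (f \o gamma).
Proof.
move=> sf sg t; apply: (smooth_at_comp (B := atlasG)) => //.
exact: vec_atlas_covering.
Qed.

Lemma continuous_mulg_pair :
  continuous (fun p : G * G => (p.1 * p.2)%g).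
Proof. by move=> p; have [] := lie_mul_smooth p. Qed.

Lemma continuous_translate g h : continuous (fun z : G => (g * z * h)%g).
Proof. by move=> z; have [] := smooth_translate g h z. Qed.

(** Differentiability is asked at 0 only, so products and images of curves are handled without their
    smoothness. Continuity at 0 keeps the curve in the chart domain for small times, where [chartV]
    inverts [chartG]. *)
Definition has_velocity alpha X :=
  [/\ alpha 0 = 1%g, {for 0, continuous alpha} &
      is_derive (0 : R) (1 : R) (chartG \o alpha) X].

Lemma velocity_unique alpha X Y :
  has_velocity alpha X -> has_velocity alpha Y -> X = Y.
Proof. by move=> [_ _ [_ <-]] [_ _ [_ <-]]. Qed.

Lemma near_curve alpha X (W : set G) : has_velocity alpha X -> nbhs 1%g W ->
  \forall t \near (0 : R), W (alpha t).
Proof. by move=> [a1 ca _] W1; apply: ca; rewrite a1. Qed.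

Lemma nbhs_chart1 : nbhs (1%g : G) (cdom (chart1 G)).
Proof. exact: near_chart_dom chart1_is_chart chart1_dom. Qed.

Lemma differentiable_chart (f : G -> G) : smooth_at atlasG atlasG f 1%g ->
  cdom (chart1 G) (f 1%g) -> differentiable (chartG \o f \o chartV) unitG.
Proof.
move=> [_ sf] f1.
have [V [oV V1 CV]] := sf _ _ chart1_atlas chart1_atlas chart1_dom f1.
exact: (CV 1%N).1.
Qed.

(** Near 0 the curve factors through the chart, so this is the chain rule. The map may move 1 within
    the chart domain, as the translations in [hom_unique] do. *)
Lemma is_derive_chart (f : G -> G) alpha X : smooth_at atlasG atlasG f 1%g ->
  cdom (chart1 G) (f 1%g) -> has_velocity alpha X ->
  is_derive (0 : R) (1 : R) (chartG \o f \o alpha)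
    ('d (chartG \o f \o chartV) unitG X).
Proof.
move=> sf f1 va; have [a1 ca da] := va.
have df := differentiable_chart sf f1.
apply: (@near_eq_is_derive _ _ _ ((chartG \o f \o chartV) \o (chartG \o alpha))).
  apply: filterS (near_curve va nbhs_chart1) => t at1.
  by rewrite /= (chart_cancel chart1_is_chart at1).
have := is_derive_diff_comp (c := chartG \o alpha) (t := 0)
  (f := chartG \o f \o chartV) da.
by rewrite /= a1; exact.
Qed.

Lemma has_velocity_tangent1 (f : G -> G) alpha X :
  smooth_at atlasG atlasG f 1%g -> f 1%g = 1%g -> has_velocity alpha X ->
  has_velocity (f \o alpha) (tangent1 f X).
Proof.
move=> sf f1 va; have [a1 ca da] := va; split; first by rewrite /= a1.
  by apply: continuous_comp => //; rewrite a1; have [] := sf.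
by have := is_derive_chart sf _ va; rewrite f1 => /(_ chart1_dom).
Qed.

Lemma has_velocity_cst : has_velocity (cst 1%g) 0.
Proof.
split=> //; first exact: cst_continuous.
rewrite (_ : _ \o _ = cst unitG) //; exact: is_derive_cst.
Qed.

Let mul_chart (p : 'rV[R]_n * 'rV[R]_n) := chartG (chartV p.1 * chartV p.2)%g.

Lemma differentiable_mul_chart : differentiable mul_chart (unitG, unitG).
Proof.
have [_ sm] := @lie_mul_smooth R n G (1%g, 1%g).
have m1 : cdom (chart1 G) ((1%g, 1%g : G).1 * (1%g : G, 1%g : G).2)%g.
  by rewrite mulg1; exact: chart1_dom.
have [V [oV V1 CV]] := sm (prod_chart (chart1 G) (chart1 G)) (chart1 G)
  (ex_intro _ _ (ex_intro _ _ (And3 chart1_atlas chart1_atlas erefl)))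
  chart1_atlas (conj chart1_dom chart1_dom) m1.
exact: (CV 1%N).1.
Qed.

Lemma is_derive_mul_chart alpha beta X Y :
  has_velocity alpha X -> has_velocity beta Y ->
  is_derive (0 : R) (1 : R) (fun t => chartG (alpha t * beta t)%g)
    ('d mul_chart (unitG, unitG) (X, Y)).
Proof.
move=> va vb; have [a1 ca da] := va; have [b1 cb db] := vb.
have dp : is_derive (0 : R) (1 : R)
    (fun t : R => ((chartG \o alpha) t, (chartG \o beta) t)) (X, Y).
  have [da1 daX] := da; have [db1 dbY] := db.
  have /derivable1_diffP/differentiableP ia := da1.
  have /derivable1_diffP/differentiableP ib := db1.
  have [dd dE] := is_diff_pair ia ib.
  split; first exact: diff_derivable.
  by rewrite deriveE// dE -daX -dbY !deriveE.
apply: (@near_eq_is_derive _ _ _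
    (mul_chart \o (fun t => ((chartG \o alpha) t, (chartG \o beta) t)))).
  near=> t; rewrite /mul_chart /=.
  rewrite (chart_cancel chart1_is_chart); last first.
    by near: t; exact: near_curve va nbhs_chart1.
  rewrite (chart_cancel chart1_is_chart) //.
  by near: t; exact: near_curve vb nbhs_chart1.
have := is_derive_diff_comp (f := mul_chart) dp.
by rewrite /= a1 b1; apply; exact: differentiable_mul_chart.
Unshelve. all: by end_near. Qed.

(** The differential of the product at (1, 1) is linear, hence determined by its values at (X, 0)
    and (0, Y). These are read off by replacing one of the two curves by the constant 1. *)
Lemma has_velocity_mul alpha beta X Y :
  has_velocity alpha X -> has_velocity beta Y ->
  has_velocity (fun t => (alpha t * beta t)%g) (X + Y).
Proof.
move=> va vb; have [a1 ca da] := va; have [b1 cb db] := vb.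
split; first by rewrite a1 b1 mulg1.
  apply: (@continuous_comp _ _ _ (fun t => (alpha t, beta t))
    (fun p : G * G => (p.1 * p.2)%g)); first exact: cvg_pair.
  exact: continuous_mulg_pair.
have := is_derive_mul_chart va vb.
rewrite (_ : (X, Y) = (X, 0) + (0, Y)); last first.
  by congr (_, _); rewrite /= ?addr0 ?add0r.
rewrite linearD.
have -> : 'd mul_chart (unitG, unitG) (X, 0) = X.
  have := is_derive_mul_chart va has_velocity_cst.
  have -> : (fun t => chartG (alpha t * cst 1 t)%g) = chartG \o alpha.
    by apply/funext => t /=; rewrite mulg1.
  by move=> dX; apply: is_derive_unique dX da.
have -> // : 'd mul_chart (unitG, unitG) (0, Y) = Y.
have := is_derive_mul_chart has_velocity_cst vb.
have -> : (fun t => chartG (cst 1 t * beta t)%g) = chartG \o beta.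
  by apply/funext => t /=; rewrite mul1g.
by move=> dY; apply: is_derive_unique dY db.
Qed.

Lemma has_velocity_scale alpha X (s : R) :
  has_velocity alpha X -> has_velocity (fun t => alpha (s * t)) (s *: X).
Proof.
move=> [a1 ca da]; split; first by rewrite mulr0.
  apply: (@continuous_comp _ _ _ ( *%R s) alpha); first exact: mulrl_continuous.
  by rewrite mulr0.
have [da1 <-] := da.
have dd : differentiable (chartG \o alpha) (s * 0).
  by rewrite mulr0; exact/derivable1_diffP.
have ds : is_derive (0 : R) (1 : R) ( *%R s) s.
  have := @is_deriveZ _ _ _ id s (0 : R) 1 1 (is_derive_id _ _).
  by rewrite /GRing.scale /= mulr1.
have := is_derive_diff_comp (f := chartG \o alpha) ds dd.
rewrite mulr0 -[X in 'd _ _ X]mulr1 -[s * 1]/(s *: 1) linearZ /=.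
by rewrite -deriveE //; exact/derivable1_diffP.
Qed.

Definition is_hom gamma := forall s t, gamma (s + t) = (gamma s * gamma t)%g.

Lemma hom0 gamma : is_hom gamma -> gamma 0 = 1%g.
Proof.
move=> hg; have := hg 0 0; rewrite addr0.
by move=> /(congr1 (fun z => (gamma 0)^-1 * z)%g); rewrite mulKg mulVg.
Qed.

Lemma homN gamma t : is_hom gamma -> gamma (- t) = (gamma t)^-1%g.
Proof.
move=> hg; have := hg t (- t); rewrite subrr (hom0 hg).
by move=> /(congr1 (fun z => (gamma t)^-1 * z)%g); rewrite mulKg mulg1.
Qed.

Lemma hom_eq_nat gamma gamma' s k : is_hom gamma -> is_hom gamma' ->
  gamma s = gamma' s -> gamma (k%:R * s) = gamma' (k%:R * s).
Proof.
move=> hg hg' e; elim: k => [|k IH]; first by rewrite mul0r !hom0.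
by rewrite -addn1 natrD mulrDl mul1r hg hg' IH e.
Qed.

(** The mean value theorem is scalar, so it is applied to each coordinate. *)
Lemma derive0_cst (f : R -> 'rV[R]_n) (e : R) :
  (forall t, `|t| < e -> is_derive t (1 : R) f 0) ->
  forall t, 0 <= t < e -> f t = f 0.
Proof.
move=> df t /andP[]; rewrite le_eqVlt => /orP[/eqP <- //|t0] te.
apply/rowP => i.
have de s : `|s| < e -> is_derive s (1 : R) (fun u => f u 0 i) 0.
  move=> /df [d1 d2]; split; first exact: (iffLR (derivable_mxP _ _ _) d1).
  by have := derive_mx d1; rewrite d2 => /matrixP/(_ 0 i); rewrite !mxE.
have ns s : s \in `[0, t] -> `|s| < e.
  by rewrite in_itv /= => /andP[s0 st]; rewrite ger0_norm //; exact: le_lt_trans st te.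
have [||c _] := @MVT R (fun u => f u 0 i) (cst 0) 0 t t0.
- by move=> s st; apply: de; apply: ns; exact: subset_itv_oo_cc.
- by apply: derivable_within_continuous => s /ns /de [].
- by rewrite mul0r => /eqP; rewrite subr_eq0 => /eqP.
Qed.

(* The derivative of [gamma t * gamma' (- t)] vanishes, so this curve is
   locally constant; no uniqueness theorem for differential equations is needed. *)
Lemma hom_unique gamma gamma' X : is_hom gamma -> is_hom gamma' ->
  has_velocity gamma X -> has_velocity gamma' X -> gamma = gamma'.
Proof.
move=> hg hg' vg vg'.
pose psi t := (gamma t * gamma' (- t))%g.
have vpsi : has_velocity psi 0.
  have := has_velocity_mul vg (has_velocity_scale (-1) vg').
  rewrite scaleN1r subrr; congr has_velocity; apply/funext => t.
  by rewrite /psi mulN1r.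
(* This formula moves the derivative from 0 to [t]: near [t], [psi] is a two-sided translate of
   [psi] near 0. *)
have psiD t u : psi (u + t) = (gamma t * psi u * gamma' (- t))%g.
  by rewrite /psi addrC hg opprD addrC hg' !mulgA.
have /nbhs_ballP[e /= e0 he] := near_curve vpsi nbhs_chart1.
have dom t : `|t| < e -> cdom (chart1 G) (psi t).
  by move=> te; apply: he; rewrite -ball_normE /= sub0r normrN.
have dpsi t : `|t| < e -> is_derive t (1 : R) (chartG \o psi) 0.
  move=> te.
  have := is_derive_chart (f := fun z => (gamma t * z * gamma' (- t))%g)
    (smooth_translate _ _ 1%g) _ vpsi.
  rewrite mulg1 linear0 => /(_ (dom t te)).
  set f := (X in is_derive _ _ X _) => df.
  have -> : chartG \o psi = f \o (fun u => u - t).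
    by apply/funext => u; rewrite /f /= -psiD subrK.
  have ds : is_derive t (1 : R) (fun u : R => u - t) 1.
    have := is_deriveB (is_derive_id t 1) (is_derive_cst t t (1 : R)).
    by rewrite subr0.
  have [df1 df2] := df.
  have ddf : differentiable f (t - t).
    by rewrite subrr; exact/derivable1_diffP.
  have := is_derive_diff_comp ds ddf.
  by rewrite subrr -deriveE ?df2 //; exact/derivable1_diffP.
have psi1 t : 0 <= t < e -> gamma t = gamma' t.
  move=> te; have := derive0_cst dpsi te.
  have [t0 te'] := andP te.
  rewrite /= => /(congr1 chartV).
  rewrite !(chart_cancel chart1_is_chart); last 2 first.
  - by apply: dom; rewrite normr0; exact: le_lt_trans t0 te'.
  - by apply: dom; rewrite ger0_norm.
  rewrite /psi oppr0 !hom0 // mulg1 homN // => /(congr1 (fun z => z * gamma' t)%g).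
  by rewrite mulgVK mul1g.
(* Past [e], divide [t] by a large integer [k] to land in [0, e), then take [k]-th powers. *)
have pos t : 0 <= t -> gamma t = gamma' t.
  move=> t0.
  have [k hk] : exists k : nat, t / e < k%:R.
    by exists (Num.bound (t / e)); apply: archi_boundP; rewrite divr_ge0// ltW.
  have k0 : (0 : R) < k%:R by apply: le_lt_trans hk; rewrite divr_ge0// ltW.
  have -> : t = k%:R * (t / k%:R) by rewrite mulrC divfK// gt_eqF.
  apply: hom_eq_nat => //; apply: psi1; apply/andP; split.
    by rewrite divr_ge0// ltW.
  by rewrite ltr_pdivrMr// mulrC -ltr_pdivrMr.
apply/funext => t; have [t0|t0] := leP 0 t; first exact: pos.
by rewrite -[t]opprK homN// [in RHS]homN// pos// oppr_ge0 ltW.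
Qed.

Lemma one_parameter_hom X gamma : one_parameter X gamma -> is_hom gamma.
Proof. by case. Qed.

Lemma one_parameter_velocity X gamma :
  one_parameter X gamma -> has_velocity gamma X.
Proof.
move=> [sg hg dX]; have g0 := hom0 hg; have [cg sg0] := sg 0.
split=> //; rewrite -dX derive1E; apply: derivableP.
have c0 : cdom (chart1 G) (gamma 0) by rewrite g0; exact: chart1_dom.
have [V [oV V0 CV]] := sg0 _ _ erefl chart1_atlas I c0.
exact: diff_derivable ((CV 1%N).1 _ V0).
Qed.

Lemma one_parameter_cst : one_parameter 0 (cst (1%g : G)).
Proof.
split=> [t|s t|]; first exact: smooth_at_cst.
- by rewrite mulg1.
- by have [_ _ [_ <-]] := has_velocity_cst; rewrite derive1E.
Qed.

Lemma smooth_conj g : smooth atlasG atlasG (fun z => g * z * g^-1)%g.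
Proof. exact: smooth_translate. Qed.

Lemma has_velocity_conj g alpha X : has_velocity alpha X ->
  has_velocity (fun t => g * alpha t * g^-1)%g (Ad g X).
Proof.
apply: has_velocity_tangent1; first exact: smooth_conj.
by rewrite mulg1 mulgV.
Qed.

Lemma hom_conj g gamma : is_hom gamma -> is_hom (fun t => g * gamma t * g^-1)%g.
Proof. by move=> hg s t; rewrite hg !mulgA mulgVK. Qed.

Lemma one_parameter_conj g gamma X : one_parameter X gamma ->
  one_parameter (Ad g X) (fun t => g * gamma t * g^-1)%g.
Proof.
move=> og; have [sg hg _] := og.
have [_ _ [_ <-]] := has_velocity_conj g (one_parameter_velocity og).
split; [exact: smooth_curve_translate|exact: hom_conj|by rewrite derive1E].
Qed.

(** [xget] picks some one-parameter subgroup; by [hom_unique] it is [gamma]. *)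
Lemma expG1 gamma X : one_parameter X gamma -> expG G X = gamma 1.
Proof.
move=> og; rewrite /expG; case: xgetP => [g _ [gamma' og' <-]|/(_ (gamma 1))].
  congr (_ 1); apply: (@hom_unique gamma' gamma X).
  - exact: one_parameter_hom og'.
  - exact: one_parameter_hom og.
  - exact: one_parameter_velocity.
  - exact: one_parameter_velocity.
by case; exists gamma.
Qed.

Lemma expG0 : expG G 0 = 1%g.
Proof. by rewrite (expG1 one_parameter_cst). Qed.

End LieGroups.

(** * The polar decomposition *)

Section PolarDecomposition.
Context {R : realType} {n : nat} {G : lieGroupType R n}.
Variables (Theta : G -> G) (K : set G).
Hypothesis redG : real_reductive Theta K.
Implicit Types (g h : G) (X v : 'rV[R]_n).

Notation expG := (expG G).
Notation p := (ppart Theta).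

Let Theta_smooth : smooth lie_atlas lie_atlas Theta.
Proof. by have [] := red_cartan redG. Qed.

Let ThetaM g h : Theta (g * h)%g = (Theta g * Theta h)%g.
Proof. by have [_ ThM _ _] := red_cartan redG; exact: ThM. Qed.

Let Theta1 : Theta 1%g = 1%g.
Proof.
have := ThetaM 1%g 1%g; rewrite mulg1.
by move=> /(congr1 (fun z => (Theta 1%g)^-1 * z)%g); rewrite mulKg mulVg.
Qed.

Lemma KE g : K g <-> Theta g = g.
Proof. by rewrite (red_fixed redG). Qed.

Lemma K1 : K 1%g.
Proof. exact/KE. Qed.

Lemma compactK : compact K.
Proof. by have [] := red_maximal_compact redG. Qed.

Lemma ppart0 : p 0.
Proof. by rewrite /ppart /= oppr0 /tangent1 linear0. Qed.

Lemma ppartZ a v : p v -> p (a *: v).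
Proof.
rewrite /ppart /= => pv.
by rewrite {1}/tangent1 linearZ /= -/(tangent1 Theta v) pv scalerN.
Qed.

Lemma closed_ppart : closed p.
Proof.
have cT : continuous (tangent1 Theta).
  apply: diff_continuous; apply: differentiable_chart; first exact: Theta_smooth.
  by rewrite Theta1; exact: chart1_dom.
have -> : p = (fun X => tangent1 Theta X + X) @^-1` [set 0].
  apply/seteqP; split=> X /=; rewrite /ppart /=; first by move=> ->; rewrite addNr.
  by move=> /eqP; rewrite addr_eq0 => /eqP.
apply: closed_comp; last first.
  exact: (accessible_closed_set1 (hausdorff_accessible (@norm_hausdorff _ _))).
by move=> X _; apply: continuousD; [exact: cT|exact: cvg_id].
Qed.

Lemma polar_within_continuous :
  {within K `*` p, continuous (fun q : G * 'rV[R]_n => (q.1 * expG q.2)%g)}.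
Proof.
have [sm _] := red_polar redG.
apply/subspace_continuousP => q qS.
have [F [[cF _] Ff]] := sm q qS.
have Fq : F q = (q.1 * expG q.2)%g by exact: (nbhs_singleton Ff).
move=> W /= Wq; have : nbhs (F q) W by rewrite Fq.
move=> /cF; rewrite /within /=; apply: filterS2 Ff => y Ffy.
by move=> /= + Sy; rewrite Ffy.
Qed.

(** The inverse is given on all of [G], where each local extension agrees with it on a
    neighbourhood; so it is continuous outright, whereas the polar map itself is handled within K x
    p. *)
Lemma polar_inverse : exists f : G -> G * 'rV[R]_n,
  [/\ continuous f, forall g, K (f g).1 /\ p (f g).2,
      forall g, ((f g).1 * expG (f g).2)%g = g &
      forall k v, K k -> p v -> f (k * expG v)%g = (k, v)].
Proof.
have [_ [f [sf [_ fS fK Kf]]]] := red_polar redG; exists f; split.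
- move=> g; have [F [[cF _] Ff]] := sf g I.
  apply: near_continuous cF; first by apply: filterS Ff => y; exact.
- by move=> g; have := fS g I.
- by move=> g; exact: Kf.
- by move=> k v Kk pv; exact: (fK (k, v)).
Qed.

Lemma expG_inj v v' : p v -> p v' -> expG v = expG v' -> v = v'.
Proof.
move=> pv pv' e; have [f [_ _ _ fK]] := polar_inverse.
by have := fK 1%g v K1 pv; rewrite e fK//; [case|exact: K1].
Qed.

Lemma within_continuous_expG : {within p, continuous expG}.
Proof.
have := polar_within_continuous => /subspace_continuousP cpol.
apply/subspace_continuousP => v pv.
move=> W /= Wv; have W1v : nbhs (1 * expG v)%g W by rewrite mul1g.
have := cpol (1%g, v) (conj K1 pv) W W1v.
rewrite /within /= => -[[W1 W2] /= [W11 W2v] sub].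
apply: filterS W2v => w W2w pw.
suff : W (1 * expG w)%g by rewrite mul1g.
by apply: (sub (1%g, w)); split => //; [exact: nbhs_singleton W11|exact: K1].
Qed.

(* If X != 0 generated no one-parameter subgroup, expG X would be the default
   value 1 = expG 0, against the injectivity of the polar decomposition. *)
Lemma ppart_one_parameter v : p v -> exists gamma : R -> G, one_parameter v gamma.
Proof.
move=> pv; have [->|v0] := eqVneq v 0; first by
  exists (cst 1%g); exact: one_parameter_cst.
apply: contrapT => no; move/eqP: v0; apply.
apply: (expG_inj pv ppart0); rewrite expG0 /Defs.expG.
by case: xgetP => // g _ [gamma og _]; case: no; exists gamma.
Qed.

Lemma expGZ v (gamma : R -> G) t : p v -> one_parameter v gamma ->
  expG (t *: v) = gamma t.
Proof.
move=> pv og; have [gamma' og'] := ppart_one_parameter (ppartZ t pv).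
rewrite (expG1 og').
rewrite (@hom_unique _ _ _ gamma' (fun s => gamma (t * s)) (t *: v)).
- by rewrite mulr1.
- exact: one_parameter_hom og'.
- by move=> r s; rewrite mulrDr (one_parameter_hom og).
- exact: one_parameter_velocity.
- by apply: has_velocity_scale; exact: one_parameter_velocity.
Qed.

Lemma one_parameter_expG v : p v -> one_parameter v (fun t => expG (t *: v)).
Proof.
move=> pv; have [gamma og] := ppart_one_parameter pv.
rewrite (_ : (fun t => _) = gamma) //.
by apply/funext => t; exact: expGZ.
Qed.

(** Recognises an exponential from a homomorphism and its velocity; it later yields exp(v) exp(u) =
    exp(v + u) for commuting exponentials. *)
Lemma expG_curve v (gamma : R -> G) : p v -> is_hom gamma ->
  has_velocity gamma v -> forall t, gamma t = expG (t *: v).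
Proof.
move=> pv hg vg t; have og := one_parameter_expG pv.
by rewrite (hom_unique hg (one_parameter_hom og) vg (one_parameter_velocity og)).
Qed.

Lemma hom_K_kpart (gamma : R -> G) X : has_velocity gamma X ->
  (forall t, K (gamma t)) -> tangent1 Theta X = X.
Proof.
move=> vg Kg.
have := has_velocity_tangent1 (Theta_smooth 1%g) Theta1 vg.
rewrite (_ : Theta \o gamma = gamma); last first.
  by apply/funext => t; apply/KE.
by move=> /velocity_unique /(_ vg).
Qed.

(** [Theta] carries [gamma] to a homomorphism with the same velocity, hence to [gamma] itself; so
    [gamma] consists of fixed points. *)
Lemma kpart_hom_K (gamma : R -> G) X : is_hom gamma -> has_velocity gamma X ->
  tangent1 Theta X = X -> forall t, K (gamma t).
Proof.
move=> hg vg TX t; apply/KE.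
have vT := has_velocity_tangent1 (Theta_smooth 1%g) Theta1 vg.
rewrite TX in vT.
have hT : is_hom (Theta \o gamma) by move=> r s; rewrite /= hg ThetaM.
by have /(congr1 (@^~ t)) := hom_unique hT hg vT vg.
Qed.

(** The p-component of the inverse polar map is continuous, so it sends [C] to a compact, hence
    bounded, set. This turns compactness in [G] into norm bounds on p. *)
Lemma compact_expG_bounded (C : set G) : compact C ->
  exists B : R, forall v, p v -> C (expG v) -> `|v| <= B.
Proof.
move=> cC; have [f [cf _ _ fK]] := polar_inverse.
have cI : compact ((snd \o f) @` C).
  apply: continuous_compact => //; apply: continuous_subspaceT => g.
  by apply: continuous_comp; [exact: cf|exact: cvg_snd].
have [B [_ hB]] := compact_bounded cI.
(* [compact_bounded] gives every number above [B] as a bound, hence the shift by 1. *)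
exists (B + 1) => v pv Cv; apply: (hB (B + 1)); first by rewrite ltrDl.
by exists (expG v) => //=; rewrite -[expG v]mul1g fK//; exact: K1.
Qed.

Lemma compact_ppart_ball (B : R) : compact (p `&` [set v | `|v| <= B]).
Proof.
apply: bounded_closed_compact.
  exists B; split=> [|M BM v [_ vB]]; first exact: num_real.
  exact: le_trans vB (ltW BM).
apply: closedI; first exact: closed_ppart.
apply: (@closed_comp _ _ (fun v : 'rV[R]_n => `|v|) [set x | x <= B]).
  by move=> v _; exact: norm_continuous.
exact: closed_le.
Qed.

Lemma compact_polar_ball (B : R) : compact
  [set g | exists k v, [/\ K k, p v, `|v| <= B & g = (k * expG v)%g]].
Proof.
have -> : [set g | exists k v, [/\ K k, p v, `|v| <= B & g = (k * expG v)%g]] =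
   (fun q : G * 'rV[R]_n => (q.1 * expG q.2)%g) @`
     (K `*` (p `&` [set v | `|v| <= B])).
  apply/seteqP; split=> [_ [k [v [Kk pv vB ->]]]|_ [[k v] [/= Kk [pv vB]] <-]].
    by exists (k, v).
  by exists k, v.
apply: continuous_compact.
  apply: continuous_subspaceW polar_within_continuous.
  by move=> [k v] [/= Kk [pv _]].
apply: compact_setX; first exact: compactK.
exact: compact_ppart_ball.
Qed.

Lemma polar g : exists k v, [/\ K k, p v & g = (k * expG v)%g].
Proof.
have [f [_ fKp fE _]] := polar_inverse.
by exists (f g).1, (f g).2; have [Kk pv] := fKp g; split.
Qed.

End PolarDecomposition.

(** * Convex functions on the line *)

Section ConvexFunctions.
Context {R : realType}.

Lemma derive1_shift (f : R -> R) t :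
  derive1 (fun s => f (s + t)) = (fun s => derive1 f (s + t)).
Proof.
apply/funext => s; rewrite /derive1.
by under eq_fun do rewrite -addrA.
Qed.

Lemma derive1_addl (f : R -> R) c : derive1 (fun s => c + f s) = derive1 f.
Proof.
apply/funext => s; rewrite /derive1.
by under eq_fun do rewrite opprD addrACA subrr add0r.
Qed.

Variable f : R -> R.
Hypothesis df : forall t, derivable f t 1.
Hypothesis ddf : forall t, derivable (derive1 f) t 1.
Hypothesis f2 : forall t, 0 <= derive1n 2 f t.

Notation f' := (derive1 f).

Lemma convex_MVT a b : a < b ->
  exists c, [/\ a < c, c < b & f b - f a = f' c * (b - a)].
Proof.
move=> ab; have [||c] := @MVT R f f' a b ab.
- by move=> t _; rewrite derive1E; exact: derivableP.
- by apply: derivable_within_continuous => t _; exact: df.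
- by rewrite in_itv /= => /andP[ac cb] E; exists c.
Qed.

Lemma convex_derive1_le s t : s <= t -> f' s <= f' t.
Proof.
move=> st.
apply: (@ger0_derive1_ndecr R f' s t _ _ _ s t (lexx s) st (lexx t)).
- by move=> u _; exact: ddf.
- by move=> u _; exact: f2.
- by apply: derivable_within_continuous => u _; exact: ddf.
Qed.

Lemma convex_tangent t0 t : t0 <= t -> f t0 + (t - t0) * f' t0 <= f t.
Proof.
rewrite le_eqVlt => /orP[/eqP <-|t0t]; first by rewrite subrr mul0r addr0.
have [c [t0c ct E]] := convex_MVT t0t.
rewrite addrC -lerBrDr E mulrC ler_wpM2r ?subr_ge0 ?(ltW t0t)//.
exact: convex_derive1_le (ltW t0c).
Qed.

(** Monotonicity of f(t)/t, with denominators cleared: the mean slope on [0, s] is at most that on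
    [s, t]. *)
Lemma convex_ray s t : f 0 = 0 -> 0 < s -> s <= t -> t * f s <= s * f t.
Proof.
move=> f0 s0; rewrite le_eqVlt => /orP[/eqP <- //|st].
have [c [c0 cs Ec]] := convex_MVT s0; have [d [sd dt Ed]] := convex_MVT st.
have cd := convex_derive1_le (ltW (lt_trans cs sd)).
rewrite f0 !subr0 in Ec.
have -> : f t = f s + f' d * (t - s) by rewrite -Ed addrC subrK.
have H : f' c * s * (t - s) <= s * (f' d * (t - s)).
  rewrite [f' c * s]mulrC -mulrA ler_wpM2l ?(ltW s0)// ler_wpM2r//.
  by rewrite subr_ge0 ltW.
by rewrite Ec in H *; nra.
Qed.

(** The second derivative at [t0] is positive, so the slope is positive just after [t0]; being
    nondecreasing, it stays so. *)
Lemma convex_critical_derive1 t0 t : f' t0 = 0 -> derive1n 2 f t0 <> 0 ->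
  t0 < t -> 0 < f' t.
Proof.
move=> c0 d0 t0t.
have d_gt0 : 0 < derive1 f' t0 by rewrite lt_neqAle eq_sym f2 andbT; exact/eqP.
have H : (fun h => h^-1 *: (f' (h + t0) - f' t0)) @ 0^' --> derive1 f' t0.
  have := @ddf t0; rewrite /derivable /derive1.
  suff -> : (fun h => h^-1 *: ((f' \o shift t0) (h *: 1) - f' t0)) =
         (fun h => h^-1 *: (f' (h + t0) - f' t0)) by [].
  by apply/funext => h /=; rewrite /GRing.scale /= mulr1.
have N : \forall h \near (0 : R)^', 0 < h^-1 *: (f' (h + t0) - f' t0).
  by apply: (cvgr_gt (derive1 f' t0)).
have [e /= e0 he] := iffLR (nbhs_ballP _ _) N.
(* Small enough for the difference quotient to be positive, and for [t0 + h] not to exceed [t]. *)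
pose h := Num.min (e / 2) (t - t0).
have h0 : 0 < h by rewrite lt_min divr_gt0//= subr_gt0.
have he' : h < e.
  apply: le_lt_trans (_ : e / 2 < e); rewrite ?ge_min ?lexx//.
  by rewrite ltr_pdivrMr// ltr_pMr// ltr1n.
have := he h; rewrite /ball /= sub0r normrN gtr0_norm// => /(_ he') /(_ (lt0r_neq0 h0)).
rewrite c0 subr0 pmulr_rgt0 ?invr_gt0// => /lt_le_trans; apply.
by apply: convex_derive1_le; rewrite -lerBrDr ge_min lexx orbT.
Qed.

Lemma convex_critical_lt t0 t : f' t0 = 0 -> derive1n 2 f t0 <> 0 ->
  t0 < t -> f t0 < f t.
Proof.
move=> c0 d0 t0t; have [c [t0c ct E]] := convex_MVT t0t.
rewrite -subr_gt0 E mulr_gt0 ?subr_gt0//.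
exact: convex_critical_derive1 c0 d0 t0c.
Qed.

Lemma convex_critical_unbounded t0 B : f' t0 = 0 -> derive1n 2 f t0 <> 0 ->
  exists2 t, 0 < t & B < f t.
Proof.
move=> c0 d0; pose t1 := t0 + 1.
have q0 : 0 < f' t1 by apply: convex_critical_derive1 c0 d0 _; rewrite ltrDl.
(* The first two terms make [t1 + x] positive; the last lifts the tangent at [t1] to at least [B],
   and the 1 makes the inequality strict. *)
pose x := `|t1| + 1 + `|B - f t1| / f' t1.
have y0 : 0 <= `|B - f t1| / f' t1 by rewrite divr_ge0// ltW.
have x0 : 0 <= x by rewrite addr_ge0// addr_ge0.
exists (t1 + x).
  have := ler_norm (- t1); rewrite normrN /x; lra.
have := @convex_tangent t1 (t1 + x); rewrite lerDl => /(_ x0).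
apply: lt_le_trans; rewrite [t1 + x]addrC addrK -ltrBlDl.
apply: le_lt_trans (ler_norm _) _.
rewrite /x mulrDl divfK ?gt_eqF// ltrDr mulr_gt0//.
Qed.

End ConvexFunctions.

(** * Kempf-Ness functions *)

Section VectorSubspaces.
Context {R : realType} {n : nat}.

Lemma continuous_linear_rV (E : normedModType R) (l : {linear 'rV[R]_n -> E}) :
  continuous l.
Proof.
have C : Ck 0 setT (fun x : 'rV[R]_n =>
    \sum_(i < n) x 0 i *: l (delta_mx 0 i)).
  apply: Ck_sum => [|i]; first exact: openT.
  apply: Ck_scale; first exact: openT.
    by move=> x _; exact: coord_continuous.
  exact: (Ck_cst 0 setT (l (delta_mx 0 i))).
move=> x; rewrite (_ : (l : 'rV[R]_n -> E) = fun x : 'rV[R]_n =>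
    \sum_(i < n) x 0 i *: l (delta_mx 0 i)); first exact: (C x I).
apply/funext => {}x; rewrite {1}(row_sum_delta x) linear_sum.
by apply: eq_bigr => i _; rewrite linearZ.
Qed.

Lemma closed_vspace (a : {vspace 'rV[R]_n}) : closed [set v | v \in a].
Proof.
have -> : [set v | v \in a] = (fun v => projv a v - v) @^-1` [set 0].
  apply/seteqP; split=> v /=; first by move=> va; rewrite projv_id ?subrr.
  by move=> /eqP; rewrite subr_eq0 => /eqP <-; exact: memv_proj.
apply: closed_comp; last first.
  exact: (accessible_closed_set1 (hausdorff_accessible (@norm_hausdorff _ _))).
move=> v _; apply: continuousB; last exact: cvg_id.
exact: continuous_linear_rV.
Qed.

Lemma bounded_line (v : 'rV[R]_n) (B : R) :
  (forall t : R, `|t *: v| <= B) -> v = 0.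
Proof.
move=> H; apply/eqP; rewrite -normr_eq0; apply/negPn/negP => v0.
have := H ((`|B| + 1) / `|v|).
rewrite normrZ normrM normfV normr_id divfK// ger0_norm ?addr_ge0// => /le_lt_trans.
move=> /(_ (`|B| + 1)); rewrite (le_lt_trans (ler_norm B)) ?ltrDl//.
by move=> /(_ isT); rewrite ltxx.
Qed.

End VectorSubspaces.

Section KempfNessFunctions.
Context {R : realType} {n : nat} {G : lieGroupType R n}.
Variables (Theta : G -> G) (K : set G).
Variables (M : topologicalType) (act : G -> M -> M) (Psi : M -> G -> R).
Hypothesis redG : real_reductive Theta K.
Hypothesis actG : continuous_action act.
Hypothesis KN : kempf_ness Theta K act Psi.
Implicit Types (g h : G) (X v w : 'rV[R]_n) (x y : M).

Notation expG := (expG G).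
Notation p := (ppart Theta).
Notation grad := (gradient_map Psi).
Notation stab := (stabilizer act).

Let act1 x : act 1%g x = x.
Proof. by have [a1 _ _] := actG. Qed.

Let actM g h x : act (g * h)%g x = act g (act h x).
Proof. by have [_ aM _] := actG. Qed.

Let actK g x : act g^-1%g (act g x) = x.
Proof. by rewrite -actM mulVg act1. Qed.

Lemma cocycle x g h : Psi x (h * g)%g = Psi x g + Psi (act g x) h.
Proof. by rewrite (kn_cocycle KN). Qed.

Lemma Psi1 x : Psi x 1%g = 0.
Proof.
have := cocycle x 1%g 1%g; rewrite act1 mulg1 => /eqP.
by rewrite -subr_eq0 opprD addrA subrr add0r oppr_eq0 => /eqP.
Qed.

(** * Kempf-Ness functions along rays *)

Definition ray x v (t : R) := Psi x (expG (t *: v)).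

Lemma expGD v s t : p v -> expG ((s + t) *: v) = (expG (s *: v) * expG (t *: v))%g.
Proof. by move=> pv; have [_ + _] := one_parameter_expG redG pv; exact. Qed.

Lemma expG_commute v s t : p v ->
  (expG (s *: v) * expG (t *: v) = expG (t *: v) * expG (s *: v))%g.
Proof. by move=> pv; rewrite -!expGD// addrC. Qed.

Lemma ray0 x v : ray x v 0 = 0.
Proof. by rewrite /ray scale0r expG0 Psi1. Qed.

Lemma ray_smooth x v : p v -> smooth (vec_atlas R R) (vec_atlas R R) (ray x v).
Proof.
move=> pv; have [sg _ _] := one_parameter_expG redG pv.
have := smooth_comp_curve (kn_smooth KN x) sg; exact.
Qed.

Lemma ray_derivable x v (t : R) : p v -> derivable (ray x v) t 1.
Proof. by move=> pv; exact: smooth_derivable (ray_smooth x pv) t. Qed.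

Lemma ray_derivable2 x v (t : R) : p v -> derivable (derive1 (ray x v)) t 1.
Proof. by move=> pv; exact: smooth_derivable2 (ray_smooth x pv) t. Qed.

Lemma ray_convex x v t : p v -> 0 <= derive1n 2 (ray x v) t.
Proof. by move=> pv; exact: kn_convex KN _ _ _ pv. Qed.

Lemma ray_shift x v t : p v ->
  (fun s => ray x v (s + t)) =
  (fun s => ray x v t + ray (act (expG (t *: v)) x) v s).
Proof. by move=> pv; apply/funext => s; rewrite /ray expGD// cocycle. Qed.

Lemma derive1_ray x v t : p v ->
  derive1 (ray x v) t = grad (act (expG (t *: v)) x) v.
Proof.
move=> pv; have := congr1 (fun f => derive1 f 0) (ray_shift x t pv).
by rewrite derive1_shift derive1_addl add0r.
Qed.

Lemma derive2_ray x v t : p v ->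
  derive1n 2 (ray x v) t = derive1n 2 (ray (act (expG (t *: v)) x) v) 0.
Proof.
move=> pv; have := congr1 (fun f => derive1 (derive1 f) 0) (ray_shift x t pv).
by rewrite derive1_shift derive1_addl derive1_shift add0r.
Qed.

(** Flatness at [t] makes exp(sv) fix exp(tv)x. As exp(sv) and exp(tv) commute, exp(sv) then fixes
    [x]. *)
Lemma flat_ray x v t : p v -> derive1n 2 (ray x v) t = 0 ->
  forall s, stab x (expG (s *: v)).
Proof.
move=> pv; rewrite derive2_ray// => /(iffLR (kn_flat KN _ pv)) H s.
have := H s; rewrite /stabilizer /= -actM expG_commute// actM.
by move=> /(congr1 (act (expG (t *: v))^-1%g)); rewrite !actK.
Qed.

(** * Critical points and minima *)

Lemma min_gradient x g v : p v ->
  (forall t, Psi x g <= Psi x (expG (t *: v) * g)%g) -> grad (act g x) v = 0.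
Proof.
move=> pv H.
have [||||_ E] := @derive1_at_min R (ray (act g x) v) (- 1) 1 0.
- by rewrite lerNl; lra.
- by move=> t _; exact: ray_derivable.
- by rewrite in_itv /=; apply/andP; split; lra.
- by move=> t _; rewrite ray0; have := H t; rewrite cocycle lerDl.
by rewrite /gradient_map derive1E.
Qed.

(** Write g = k exp(v): the value is that of a ray at time 1, which lies above its tangent at 0, and
    this tangent is zero. *)
Lemma critical_min y : (forall v, p v -> grad y v = 0) -> forall g, 0 <= Psi y g.
Proof.
move=> cy g; have [k [v [Kk pv ->]]] := polar redG g.
rewrite (kn_invariant KN _ _ Kk).
have := convex_tangent (fun t => @ray_derivable y v t pv)
  (fun t => @ray_derivable2 y v t pv) (fun t => @ray_convex y v t pv) (@ler01 R).
by rewrite ray0 [derive1 _ _]cy// mulr0 addr0 /ray scale1r.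
Qed.

(* Properness of the Kempf-Ness function modulo K. *)
Definition coercive x := forall c : R, exists B : R,
  forall v, p v -> Psi x (expG v) <= c -> `|v| <= B.

Lemma within_continuous_Psi x :
  {within p, continuous (fun v => Psi x (expG v))}.
Proof.
have := within_continuous_expG redG => /subspace_continuousP cE.
apply/subspace_continuousP => v pv W /= Wv.
have [cPsi _] := kn_smooth KN x (expG v).
exact: cE v pv _ (cPsi W Wv).
Qed.

(** A positive value forces at least linear growth along a ray. Compactness of the unit sphere of p
    makes the time needed to exceed a given level uniform in the direction. *)
Lemma coercive_rays x :
  (forall v, p v -> v != 0 -> exists2 t, 0 < t & 0 < ray x v t) -> coercive x.
Proof.
move=> H c; pose c1 := Num.max c 0.
have growth v s t : p v -> 0 < s -> s <= t -> t * ray x v s <= s * ray x v t.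
  move=> pv; apply: convex_ray (ray0 x v) => u.
  - exact: ray_derivable.
  - exact: ray_derivable2.
  - exact: ray_convex.
pose S : set 'rV[R]_n := (p `&` [set v | `|v| <= 1]) `&` [set v | `|v| = 1].
have cS : compact S.
  apply: compact_closedI; first exact: (@compact_ppart_ball _ _ _ _ _ redG 1).
  apply: (@closed_comp _ _ (fun v : 'rV[R]_n => `|v|) [set r | r = 1]).
    by move=> v _; exact: norm_continuous.
  exact: closed_eq.
have near_S v : S v -> \forall v' \near v & t \near +oo_R,
    p v' -> c1 < ray x v' t.
  move=> [[pv _] /= v1].
  have v0 : v != 0 by rewrite -normr_eq0 v1 oner_neq0.
  have [s s0 fs0] := H v pv v0.
  have c10 : 0 <= c1 by rewrite le_max lexx orbT.
  (* Chosen so that the linear lower bound at [t0] is [c1 + ray x v s], above [c1]. Since [c1] is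
     nonnegative, [t0] is at least [s] and the bound persists after [t0]. *)
  pose t0 := s * (c1 / ray x v s + 1).
  have st0 : s <= t0.
    by rewrite ler_pMr// lerDr divr_ge0// ltW.
  have t00 : 0 < t0 by exact: lt_le_trans st0.
  have ft0 : c1 < ray x v t0.
    have := growth v s t0 pv s0 st0.
    rewrite -mulrA ler_pM2l// mulrDl mul1r divfK ?gt_eqF// => /lt_le_trans; apply.
    by rewrite ltrDl.
  have N : \forall v' \near v, p v' -> c1 < ray x v' t0.
    have := @within_continuous_Psi x => /subspace_continuousP /(_ _ (ppartZ t0 pv)).
    move=> /(_ [set r | c1 < r]) /(_ (lt_nbhsr ft0)).
    rewrite /within /= => N.
    have N' : \forall v' \near v, p (t0 *: v') -> c1 < ray x v' t0.
      exact: (@scaler_continuous _ _ t0 v _ N).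
    by apply: filterS N' => v' /= Hv' pv'; apply: Hv'; exact: ppartZ.
  exists ([set v' | p v' -> c1 < ray x v' t0], [set t | t0 <= t]).
    by split; [exact: N|exact: (nbhs_pinfty_ge (num_real t0))].
  move=> [v' t] [/= N' t0t] pv'.
  have ft0' := N' pv'.
  have G1 := growth v' t0 t pv' t00 t0t.
  have G2 : t0 * ray x v' t0 <= t * ray x v' t0.
    by rewrite ler_wpM2r// ltW// (le_lt_trans c10).
  have := le_trans G2 G1; rewrite ler_pM2l// => /(lt_le_trans ft0'); exact.
have [B [_ HB]] := iffLR (compact_near_coveringP _) cS _ _
  (fun t v => p v -> c1 < ray x v t) _ near_S.
(* The maximum with 0 rules out v = 0 in the contrary case, so [v] can be normalised; its norm then
   serves as the time along the unit direction. *)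
exists (Num.max B 0) => v pv vc; rewrite leNgt; apply/negP.
rewrite gt_max => /andP[Bv v0].
have nv0 : `|v| != 0 by rewrite gt_eqF.
have nv1 : `| `|v|^-1 *: v| = 1 by rewrite normrZ normfV normr_id mulVf.
have Sv : S (`|v|^-1 *: v).
  by split=> //; split; [exact: ppartZ|rewrite /= nv1].
have := HB _ Bv _ Sv (ppartZ _ pv).
rewrite /ray scalerA divff// scale1r => /lt_le_trans /(_ vc).
by rewrite ltNge /c1 le_max lexx.
Qed.

(** By the cocycle identity, a bound on [Psi x] at exp(v) bounds [Psi (act g x)] at exp(v) g^-1. So
    exp(v) g^-1 lies in a compact set K exp(ball), and exp(v) in a compact translate of it. *)
Lemma coercive_translate x g : coercive (act g x) -> coercive x.
Proof.
move=> Hg c; have [B0 HB0] := Hg (c - Psi x g).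
have cC := @compact_polar_ball _ _ _ _ _ redG B0.
set C := [set _ | _] in cC.
have cCg : compact ((fun z => 1 * z * g)%g @` C).
  apply: continuous_compact => //; apply: continuous_subspaceT.
  exact: continuous_translate.
have [B HB] := compact_expG_bounded redG cCg.
exists B => v pv vc; apply: HB => //.
exists (expG v * g^-1)%g; last by rewrite mul1g mulgVK.
have [k [w [Kk pw E]]] := polar redG (expG v * g^-1)%g.
exists k, w; split=> //; apply: HB0 => //.
rewrite -(kn_invariant KN _ _ Kk) -E lerBrDr addrC -cocycle mulgVK.
exact: vc.
Qed.

(** A minimum exists on a compact part of [C] containing 0 and all points of value at most 0;
    elsewhere the value exceeds the one at 0. Used with [C] equal to p and to a subalgebra. *)
Lemma coercive_min x (C : set 'rV[R]_n) : coercive x -> closed C -> C 0 ->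
  C `<=` p -> exists2 u, C u & forall w, C w -> Psi x (expG u) <= Psi x (expG w).
Proof.
move=> cx clC C0 Cp; have [B HB] := cx 0.
have Psi0 : Psi x (expG 0) = 0 by rewrite expG0 Psi1.
have D0 : ((p `&` [set v | `|v| <= B]) `&` C) 0.
  by split=> //; split; [exact: Cp|apply: HB; [exact: Cp|rewrite Psi0]].
have [|u] := compact_EVT_min (f := fun v => Psi x (expG v))
  (ex_intro _ _ D0) (@compact_closedI _ _ _ (@compact_ppart_ball _ _ _ _ _ redG B) clC).
  apply: continuous_subspaceW (@within_continuous_Psi x).
  by move=> v [[]].
rewrite inE => -[_ Cu] minu; exists u => // w Cw.
have [w0|w0] := leP (Psi x (expG w)) 0.
  apply: minu; rewrite inE; split=> //; split; first exact: Cp.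
  by apply: HB => //; exact: Cp.
by apply: le_trans (ltW w0); rewrite -Psi0; apply: minu; rewrite inE.
Qed.

Lemma coercive_line y v : coercive y -> p v ->
  (forall t, Psi y (expG (t *: v)) <= 0) -> v = 0.
Proof.
move=> cy pv H; have [B HB] := cy 0.
by apply: (@bounded_line _ _ _ B) => t; apply: HB; [exact: ppartZ|exact: H].
Qed.

(** For h = k exp(v) fixing [y], the nonnegative values at h and h^-1 add up to 0. So the ray along
    [v] returns to 0 at time 1, which forces flatness at 0 and exp(Rv) to fix [y]. The ray is then
    additive and nonnegative, hence zero, and coercivity gives v = 0. *)
Lemma stabilizer_critical y : coercive y ->
  (forall v, p v -> grad y v = 0) -> stab y `<=` K.
Proof.
move=> cy gy h sh; have Psi_ge0 := critical_min gy.
have Psih : Psi y h = 0.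
  apply/eqP; rewrite eq_le Psi_ge0 andbT.
  have := cocycle y h h^-1%g; rewrite mulVg Psi1 (_ : act h y = y) // => E.
  by have := Psi_ge0 h^-1%g; lra.
have [k [v [Kk pv hE]]] := polar redG h.
have rv : ray y v 1 = 0.
  by rewrite /ray scale1r -(kn_invariant KN _ _ Kk) -hE.
have flat : derive1n 2 (ray y v) 0 = 0.
  apply: contrapT => d0.
  have := convex_critical_lt (fun t => @ray_derivable y v t pv)
    (fun t => @ray_derivable2 y v t pv) (fun t => @ray_convex y v t pv) (gy v pv) d0
    (@ltr01 R).
  by rewrite rv ray0 ltxx.
have sv := flat_ray pv flat.
have rayD s t : ray y v (s + t) = ray y v t + ray y v s.
  have := congr1 (@^~ s) (ray_shift y t pv).
  by rewrite (_ : act _ y = y); [exact|exact: sv].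
suff v0 : v = 0 by rewrite hE v0 expG0 mulg1.
apply: (coercive_line cy pv) => t.
have := rayD t (- t); rewrite subrr ray0 => E.
have := Psi_ge0 (expG (- t *: v)); rewrite -/(ray y v (- t)) -/(ray y v t); lra.
Qed.

(** * From G-stability to A-stability *)

Lemma G_stable_A_stable x (a : {vspace 'rV[R]_n}) : G_stable Theta act Psi x ->
  (forall v, v \in a -> p v) ->
  (forall g h : G, exp_group a g -> exp_group a h -> (g * h = h * g)%g) ->
  A_stable act Psi a x.
Proof.
move=> [[g0 gy] [g gk]] ap ca.
(* The compact set g^-1 K g contains every one-parameter subgroup that fixes [x]. *)
have [C cC stabC] : exists2 C : set G, compact C &
    forall X gamma, one_parameter X gamma -> (forall t, stab x (gamma t)) ->
    forall t, C (gamma t).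
  exists ((fun z => g^-1 * z * g)%g @` K).
    apply: continuous_compact (compactK redG).
    by apply: continuous_subspaceT; exact: continuous_translate.
  move=> X gamma og sg t; exists (g * gamma t * g^-1)%g; last first.
    by rewrite !mulgA mulVg mul1g mulgVK.
  have og' := one_parameter_conj g og.
  apply: (kpart_hom_K redG (one_parameter_hom og') (one_parameter_velocity og')).
  by apply: gk; exists X => //; exists gamma.
(* A ray flat at 0 would make exp(Rv) fix [act g0 x]; conjugated by g0^-1 it fixes [x] and lies in
   [C], so exp(Rv) would be relatively compact and v = 0. *)
have cy : coercive (act g0 x).
  apply: coercive_rays => v pv v0; exists 1 => //.
  rewrite -(ray0 (act g0 x) v).
  apply: (convex_critical_lt (fun t => @ray_derivable (act g0 x) v t pv)
    (fun t => @ray_derivable2 (act g0 x) v t pv)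
    (fun t => @ray_convex (act g0 x) v t pv)) (gy v pv) _ (@ltr01 R) => flat.
  have sv := flat_ray pv flat.
  have cD : compact ((fun z => g0 * z * g0^-1)%g @` C).
    apply: continuous_compact cC.
    by apply: continuous_subspaceT; exact: continuous_translate.
  have [B HB] := compact_expG_bounded redG cD.
  case/eqP: v0; apply: (@bounded_line _ _ _ B) => t.
  apply: HB; first exact: ppartZ.
  exists (g0^-1 * expG (t *: v) * g0^-1^-1)%g; last first.
    by rewrite invgK !mulgA mulgV mul1g mulgK.
  apply: (stabC _ _ (one_parameter_conj g0^-1%g (one_parameter_expG redG pv))).
  by move=> s; rewrite /stabilizer /= invgK !actM sv actK.
have [u ua minu] := coercive_min (coercive_translate cy) (@closed_vspace _ _ a)
  (mem0v a) ap.
split.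
  exists (expG u); first by exists u.
  move=> v va; apply: min_gradient (ap v va) _ => t.
  have pvu : p (t *: v + u) by apply: ap; rewrite memvD// memvZ.
  suff -> : (expG (t *: v) * expG u)%g = expG (t *: v + u).
    by apply: minu; rewrite /= memvD// memvZ.
  have ptv : p (t *: v) by exact/ppartZ/ap.
  have pu : p u by exact: ap.
  (* Commutativity of exp(a) makes this product a homomorphism; its velocity is [t *: v + u]. *)
  pose gamma s := (expG (s *: (t *: v)) * expG (s *: u))%g.
  have ov := one_parameter_expG redG ptv; have ou := one_parameter_expG redG pu.
  have hg : is_hom gamma.
    move=> r s; rewrite /gamma !expGD// -!mulgA; congr (_ * _)%g.
    rewrite !mulgA; congr (_ * _)%g; apply: ca.
      by exists (s *: (t *: v)) => //=; rewrite !memvZ.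
    by exists (r *: u) => //=; rewrite memvZ.
  have vg := has_velocity_mul (one_parameter_velocity ov) (one_parameter_velocity ou).
  by have := expG_curve redG pvu hg vg 1; rewrite /gamma !scale1r.
apply/seteqP; split=> [X [gamma og sg]|_ ->]; last first.
  exists (cst 1%g); first exact: one_parameter_cst.
  move=> t; split; first exact: act1.
  by exists 0; [exact: mem0v|exact: expG0].
have [B HB] := compact_expG_bounded redG cC.
have Cg := stabC X gamma og (fun t => (sg t).1).
(* [X] is not known to lie in [a], so one argues on values: if gamma(t) = exp(u0), then gamma(kt) =
   exp(k u0) stays in [C] for every natural k, which bounds k|u0| and forces u0 = 0. *)
have g1 t : gamma t = 1%g.
  have [_ [u0 u0a u0E]] := sg t.
  suff u00 : u0 = 0 by rewrite -u0E u00 expG0.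
  have pu0 := ap _ u0a.
  have Bn k : k%:R * `|u0| <= B.
    have [_ [w wa wE]] := sg (k%:R * t).
    have pw := ap _ wa.
    have <- : `|w| = k%:R * `|u0|.
      suff -> : w = k%:R *: u0 by rewrite normrZ normr_nat.
      apply: (expG_inj redG pw (ppartZ _ pu0)); rewrite wE.
      have ou := one_parameter_expG redG pu0.
      rewrite -[k%:R *: u0]scale1r.
      have := @hom_eq_nat _ _ _ (fun s => gamma (s * t)) (fun s => expG (s *: u0)) 1 k.
      rewrite !mul1r !mulr1 scale1r u0E => ->//.
      - by rewrite scale1r.
      - by move=> r s; rewrite mulrDl (one_parameter_hom og).
      - exact: one_parameter_hom ou.
    by apply: HB => //; rewrite wE.
  apply/eqP; rewrite -normr_eq0; apply/negPn/negP => nu0.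
  have nu0' : 0 < `|u0| by rewrite lt_neqAle eq_sym nu0 /=.
  have := Bn (Num.bound (`|B| / `|u0|)).
  rewrite leNgt => /negP; apply; apply: le_lt_trans (ler_norm B) _.
  by rewrite -ltr_pdivrMr//; apply: archi_boundP; rewrite divr_ge0.
have := one_parameter_velocity og; rewrite (_ : gamma = cst 1%g).
  by move=> /velocity_unique; apply; exact: has_velocity_cst.
exact/funext.
Qed.

(** * From A-stability on lines to G-stability *)

Lemma lie_bracket_line v s t : p v -> lie_bracket G (s *: v) (t *: v) = 0.
Proof.
move=> pv; rewrite /lie_bracket linearZ /=.
set Phi := (fun u => _).
suff -> : 'd Phi (cfun (chart1 G) (1%g : G)) v = 0 by rewrite scaler0.
(* If [Phi] is differentiable, its derivative along [v] is computed on the curve exp(rv). There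
   [Phi] is constant, since exp(rv) commutes with exp(sv) and so Ad(exp(rv)) fixes [v]. *)
have [df|/diff_nondifferentiable -> //] :=
  pselect (differentiable Phi (cfun (chart1 G) (1%g : G))).
have ov := one_parameter_expG redG pv.
have [g0 cg dg] := one_parameter_velocity ov.
have := is_derive_diff_comp (f := Phi) dg.
rewrite /= g0 => /(_ df) [_ <-].
rewrite (near_eq_derive (g := cst (t *: v))) ?derive_cst//.
apply: filterS (near_curve (one_parameter_velocity ov) nbhs_chart1) => r dr.
rewrite /Phi /= (chart_cancel chart1_is_chart dr) /Ad /tangent1 linearZ /=.
congr (_ *: _).
have := has_velocity_conj (expG (r *: v)) (one_parameter_velocity ov).
move/velocity_unique; apply.
rewrite (_ : (fun s => _) = fun s => expG (s *: v)).
  exact: one_parameter_velocity.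
by apply/funext => s'; rewrite expG_commute// mulgK.
Qed.

(** The zero of the gradient on the orbit is a critical time [t0] of the ray. Flatness there would
    put the nonzero [v] in the stabilizer algebra, so the ray is unbounded above at positive
    times. *)
Lemma A_stable_line x v : p v -> v != 0 -> A_stable act Psi <[v]>%VS x ->
  exists2 t, 0 < t & 0 < ray x v t.
Proof.
move=> pv v0 [[_ [_ /vlineP[t0 ->] <-] gx] la].
apply: (convex_critical_unbounded (fun t => @ray_derivable x v t pv)
    (fun t => @ray_derivable2 x v t pv) (fun t => @ray_convex x v t pv) (t0 := t0)).
  by rewrite derive1_ray//; apply: gx; exact: memv_line.
move=> /(flat_ray pv) sv; case/eqP: v0.
suff : lie_alg (stab x `&` exp_group <[v]>%VS) v by rewrite la.
exists (fun t => expG (t *: v)); first exact (one_parameter_expG redG pv).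
move=> t; split; first exact: sv.
by exists (t *: v) => //=; apply/vlineP; exists t.
Qed.

Lemma A_stable_G_stable x :
  (forall v, p v -> A_stable act Psi <[v]>%VS x) -> G_stable Theta act Psi x.
Proof.
move=> Ax.
have cx : coercive x.
  by apply: coercive_rays => v pv v0; apply: A_stable_line => //; exact: Ax.
have [u pu minu] := coercive_min cx (@closed_ppart _ _ _ _ _ redG)
  (ppart0 Theta) (@subset_refl _ p).
have minG g : Psi x (expG u) <= Psi x g.
  have [k [v [Kk pv ->]]] := polar redG g.
  by rewrite (kn_invariant KN _ _ Kk); exact: minu.
have gy v : p v -> grad (act (expG u) x) v = 0.
  by move=> pv; apply: min_gradient.
split; first by exists (expG u).
have cy : coercive (act (expG u) x).
  by apply: (@coercive_translate _ (expG u)^-1%g); rewrite actK.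
(* Conjugation by exp(u) carries [gamma] into the stabilizer of the critical point, hence into [K],
   so its velocity is fixed by the differential of [Theta]. *)
exists (expG u) => _ [X [gamma og sg] <-].
apply: (hom_K_kpart redG (has_velocity_conj _ (one_parameter_velocity og))).
move=> t; apply: (stabilizer_critical cy gy).
by rewrite /stabilizer /= !actM actK sg.
Qed.

End KempfNessFunctions.

Theorem corollary28 (R : realType) (n : nat) (G : lieGroupType R n)
    (Theta : G -> G) (K : set G)
    (M : topologicalType) (act : G -> M -> M) (Psi : M -> G -> R) :
  ~ compact [set: G] ->
  real_reductive Theta K ->
  hausdorff_space M ->
  continuous_action act ->
  kempf_ness Theta K act Psi ->
  forall x : M,
    G_stable Theta act Psi x <->
    forall a : {vspace 'rV[R]_n},
      lie_subalgebra G a ->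
      (forall v, v \in a -> ppart Theta v) ->
      (forall g h : G, exp_group a g -> exp_group a h -> (g * h = h * g)%g) ->
      A_stable act Psi a x.
Proof.
move=> _ redG _ actG KN x; split=> [Gx a _|Ax].
  by move=> ap ca; exact (G_stable_A_stable redG actG KN Gx ap ca).
apply: (A_stable_G_stable redG actG KN) => v pv; apply: Ax.
- move=> _ _ /vlineP[s ->] /vlineP[t ->].
  by rewrite (lie_bracket_line redG s t pv) mem0v.
- by move=> _ /vlineP[s ->]; exact: ppartZ.
- move=> _ _ [_ /vlineP[s ->] <-] [_ /vlineP[t ->] <-].
  exact: (expG_commute redG s t pv).
Qed.
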